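(* Let $L>0$ and $T=nL$ for some $n\in\mathbb{N}$, and fix one choice of the sign $\pm$. Let $\Sigma_h$ be an $\mathcal{S}^1_{0,}(\Sigma_h)$-admissible mesh of $\Sigma$ satisfying the time-slice matching condition, and let $c_1^{\mathsf{K}}>0$ be a constant such that $$c_1^{\mathsf{K}}\|w_h\|_{H^{1/2}_{0,}(\Sigma)}\le\sup_{0\ne\mu_h\in\mathcal{S}^1_{0,}(\Sigma_h)}\frac{|\langle(\pm\frac12\mathsf{Id}+\mathsf{K})w_h,\mu_h\rangle_\Sigma|}{\|\mu_h\|_{[H^{1/2}_{0,}(\Sigma)]'}}\quad\text{for all }w_h\in\mathcal{S}^1_{0,}(\Sigma_h).$$ Let $g\in H^{1/2}_{0,}(\Sigma)$, let $z\in H^{1/2}_{0,}(\Sigma)$ be the exact solution of $(\pm\frac12\mathsf{Id}+\mathsf{K})z=g$, and let $z_h^1\in\mathcal{S}^1_{0,}(\Sigma_h)$ be the discrete solution of $$\left\langle\left(\pm\tfrac12\mathsf{Id}+\mathsf{K}\right)z_h^1,v_h\right\rangle_\Sigma=\langle g,v_h\rangle_\Sigma\quad\text{for all }v_h\in\mathcal{S}^1_{0,}(\Sigma_h).$$ Then $$\|z-z_h^1\|_{H^{1/2}_{0,}(\Sigma)}\le\left(1+\frac{\|\pm\frac12\mathsf{Id}+\mathsf{K}\|}{c_1^{\mathsf{K}}}\right)\inf_{v_h\in\mathcal{S}^1_{0,}(\Sigma_h)}\|z-v_h\|_{H^{1/2}_{0,}(\Sigma)},$$ where $\|\pm\frac12\mathsf{Id}+\mathsf{K}\|$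 is the operator norm on $H^{1/2}_{0,}(\Sigma)$.
   Context: Spaces. $\Gamma=\{0,L\}$, $\Sigma=\Gamma\times[0,T]$. A function on $\Sigma$ is a pair $v=(v_0,v_L)=(v(0,\cdot),v(L,\cdot))$ of functions on $(0,T)$; $L^2(\Sigma)=L^2(0,T)\times L^2(0,T)$. $H^1_{0,}(\Sigma)=\{v: v_0,v_L\in H^1(0,T),\ v_0(0)=v_L(0)=0\}$ with norm $\|\partial_t v\|_{L^2(\Sigma)}$, and $H^{1/2}_{0,}(\Sigma):=[H^1_{0,}(\Sigma),L^2(\Sigma)]_{1/2}$ (Hilbert interpolation). $[H^{1/2}_{0,}(\Sigma)]'$ is its dual with the dual norm, and $\langle\cdot,\cdot\rangle_\Sigma$ is the duality pairing extending the $L^2(\Sigma)$ inner product (so $L^2(\Sigma)\subset[H^{1/2}_{0,}(\Sigma)]'$). Operator. $\mathsf{Id}$ is the identity and $\mathsf{K}$ is the double layer operator of the one-dimensional wave equation: $\mathsf{K}v(0,t)=-\tfrac12 v(L,t-L)$, $\mathsf{K}v(L,t)=-\tfrac12 v(0,t-L)$, where functions on $\Sigma$ are extended by zero to times $t\le0$. Meshes. A mesh $\Sigma_h=\Sigma_h^0\cup\Sigma_h^L$ of $\Sigma$ with maximal meshwidth $h$ consists of a partition $\Sigma_h^0$ of $\{0\}\times(0,T)$ and a partition $\Sigma_h^L$ of $\{L\}\times(0,T)$ into finitely many non-overlapping intervals. $\mathcal{S}^1_{0,}(\Sigma_h)\subset H^1_{0,}(\Sigma)$ is the space of functions that are, on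 each of the two boundary components, continuous and piecewise linear with respect to the mesh, and vanish at $t=0$. Admissibility. $\Sigma_h$ is $\mathcal{S}^1_{0,}(\Sigma_h)$-admissible if the $L^2(\Sigma)$-orthogonal projection $Q_h^0$ onto $\mathcal{S}^1_{0,}(\Sigma_h)$ is $H^1$-stable, i.e. $\|Q^0_hw\|_{H^1_{0,}(\Sigma)}\le c_{s,1}\|w\|_{H^1_{0,}(\Sigma)}$ for all $w\in H^1_{0,}(\Sigma)$, with a constant $c_{s,1}$. Time-slice matching condition. With $T=nL$ and time slices $T_j:=((j-1)L,jL)$, $j=1,\dots,n$, each slice on each boundary component is a union of mesh elements (up to endpoints), and, identifying meshes on $T_j$ and $T_{j+1}$ via the time translation $t\mapsto t+L$, one has $\Sigma^0_{h|T_j}=\Sigma^L_{h|T_{j+1}}$ and $\Sigma^L_{h|T_j}=\Sigma^0_{h|T_{j+1}}$ for all $j=1,\dots,n-1$. *)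

(* Defs.v *)
From HB Require Import structures.
From mathcomp Require Import all_boot all_order all_algebra.
From mathcomp Require Import all_classical all_reals all_analysis.

Set Implicit Arguments.
Unset Strict Implicit.
Unset Printing Implicit Defensive.

Import Order.TTheory GRing.Theory Num.Theory.
Import numFieldNormedType.Exports.

Local Open Scope classical_set_scope.
Local Open Scope ring_scope.

Section Interpolation.
Context {R : realType} {V : zmodType}.

(* Exponent-1/2 interpolation between X and Y, X included in Y, by the quadratic
   K-functional  K(t,v)^2 = inf { |v - x|_Y^2 + t^2 |x|_X^2 : x in X }.  With
   the factor 2/pi, Hilbert norms on X and Y give exactly the spectral
   (Lions-Magenes) norm: for a simultaneous orthogonal basis e_k with
   |e_k|_Y = 1 and |e_k|_X^2 = lambda_k, it is sum_k sqrt(lambda_k) |v_k|^2. *)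
Definition Kfun_sq (X : set V) (nX nY : V -> R) (t : R) (v : V) : R :=
  inf [set nY (v - x) ^+ 2 + t ^+ 2 * nX x ^+ 2 | x in X].

Definition interp_sq (X : set V) (nX nY : V -> R) (v : V) : \bar R :=
  ((2 / pi)%:E * \int[lebesgue_measure]_(t in `]0%R, +oo[)
     (t ^- 2 * Kfun_sq X nX nY t v)%:E)%E.

Definition interp_space (X Y : set V) (nX nY : V -> R) : set V :=
  [set v | Y v /\ (interp_sq X nX nY v < +oo)%E].

Definition interp_norm (X : set V) (nX nY : V -> R) (v : V) : R :=
  Num.sqrt (fine (interp_sq X nX nY v)).

End Interpolation.

Section OneComponent.
Context {R : realType}.
Variable T : R.
Local Notation mu := (@lebesgue_measure R).
Implicit Types f g phi : R -> R.

(* Functions on (0,T) are represented by total functions R -> R whose values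
   outside the interval are irrelevant; elements of L^2 by representatives. *)
Definition L2I f : Prop := (f \_ `]0, T[) \in Lfun mu 2%:E.

Definition test_function phi : Prop :=
  [/\ forall t, derivable phi t 1, continuous (derive1 phi) &
      closure [set t | phi t != 0] `<=` `]0, T[].

Definition weak_derivative f g : Prop :=
  forall phi, test_function phi ->
    \int[mu]_(t in `]0, T[) (f t * derive1 phi t) =
    - \int[mu]_(t in `]0, T[) (g t * phi t).

(* The weak derivative in L^2(0,T), unique up to null sets; 0 if there is none. *)
Definition wderiv f : R -> R := xget 0 [set g | L2I g /\ weak_derivative f g].

(* The value at 0 is that of the continuous representative on [0,T]. *)
Definition H10I f : Prop :=
  [/\ L2I f, exists g, L2I g /\ weak_derivative f g &
      exists u, [/\ ae_eq mu `]0, T[%classic f u, {within `[0, T], continuous u} &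
                    u 0 = 0]].

End OneComponent.

(* A function on Sigma is the pair of its components at x = 0 and x = L. *)
Notation sigma_fun R := ((R -> R) * (R -> R))%type.

Section Sigma.
Context {R : realType}.
Variable T : R.
Local Notation mu := (@lebesgue_measure R).
Implicit Types u v w : sigma_fun R.

Definition ae_eqS u v : Prop :=
  ae_eq mu `]0, T[%classic u.1 v.1 /\ ae_eq mu `]0, T[%classic u.2 v.2.

Definition L2S : set (sigma_fun R) := [set v | L2I T v.1 /\ L2I T v.2].

(* The L^2(Sigma) inner product.  It is also the restriction to pairs of
   L^2(Sigma) functions of the duality pairing between [H^{1/2}_{0,}]' and
   H^{1/2}_{0,}, which extends it by continuity. *)
Definition pairing u v : R :=
  \int[mu]_(t in `]0, T[) (u.1 t * v.1 t) +
  \int[mu]_(t in `]0, T[) (u.2 t * v.2 t).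

Definition normL2S v : R := Num.sqrt (pairing v v).

Definition H1S : set (sigma_fun R) := [set v | H10I T v.1 /\ H10I T v.2].

Definition dt v : sigma_fun R := (wderiv T v.1, wderiv T v.2).

Definition normH1S v : R := normL2S (dt v).

Definition H12S : set (sigma_fun R) := interp_space H1S L2S normH1S normL2S.

Definition normH12S v : R := interp_norm H1S normH1S normL2S v.

(* Norm in [H^{1/2}_{0,}]' of the functional  v |-> pairing f v. *)
Definition norm_dualS (f : sigma_fun R) : R :=
  sup [set `|pairing f v| / normH12S v | v in [set v | H12S v /\ ~ ae_eqS v 0]].

Definition opnormH12S (A : sigma_fun R -> sigma_fun R) : R :=
  sup [set normH12S (A v) / normH12S v | v in [set v | H12S v /\ ~ ae_eqS v 0]].

End Sigma.

Section Operator.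
Context {R : realType}.
Variable L : R.

Definition ext0 (f : R -> R) (t : R) : R := if 0 < t then f t else 0.

Definition Kop (v : sigma_fun R) : sigma_fun R :=
  (fun t => - (2^-1 * ext0 v.2 (t - L)), fun t => - (2^-1 * ext0 v.1 (t - L))).

(* +1/2 Id + K when neg = false, -1/2 Id + K when neg = true. *)
Definition halfIdK (neg : bool) (v : sigma_fun R) : sigma_fun R :=
  (fun t => (-1) ^+ neg / 2 * v.1 t + (Kop v).1 t,
   fun t => (-1) ^+ neg / 2 * v.2 t + (Kop v).2 t).

End Operator.

Section Mesh.
Context {R : realType}.

(* Each component is given by its increasing list of nodes in (0,T], the last
   one being T; the node 0 is implicit (see itv_partition). *)
Record mesh (T : R) := Mesh {
  nodes0 : seq R;
  nodesL : seq R;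
  nodes0P : itv_partition 0 T nodes0;
  nodesLP : itv_partition 0 T nodesL
}.

(* Endpoints (a, b) of the mesh elements, in increasing order. *)
Definition elements (s : seq R) : seq (R * R) := zip (0 :: s) s.

Definition S1I (T : R) (s : seq R) (f : R -> R) : Prop :=
  [/\ {within `[0, T], continuous f}, f 0 = 0 &
      forall e, e \in elements s ->
        exists a b : R, forall t, e.1 < t < e.2 -> f t = a + b * t].

Definition S1 (T : R) (M : mesh T) : set (sigma_fun R) :=
  [set v | S1I T (nodes0 M) v.1 /\ S1I T (nodesL M) v.2].

Definition L2_projection (T : R) (M : mesh T) (w q : sigma_fun R) : Prop :=
  S1 M q /\ forall v, S1 M v -> pairing T (w - q) v = 0.

Definition S1_admissible (T : R) (M : mesh T) : Prop :=
  exists c : R, forall w q, H1S T w -> L2_projection M w q ->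
    normH1S T q <= c * normH1S T w.

(* The elements contained in the j-th time slice, j >= 1. *)
Definition slice (L : R) (j : nat) (s : seq R) : seq (R * R) :=
  [seq e <- elements s | (j.-1%:R * L <= e.1) && (e.2 <= j%:R * L)].

Definition slice_covered (L : R) (j : nat) (s : seq R) : Prop :=
  `[j.-1%:R * L, j%:R * L]%classic =
  \bigcup_(e in [set e | e \in slice L j s]) `[e.1, e.2]%classic.

Definition translate (L : R) (es : seq (R * R)) : seq (R * R) :=
  [seq (e.1 + L, e.2 + L) | e <- es].

Definition time_slice_matching (L : R) (n : nat) (T : R) (M : mesh T) : Prop :=
  (forall j, (1 <= j <= n)%N ->
     slice_covered L j (nodes0 M) /\ slice_covered L j (nodesL M)) /\
  (forall j, (1 <= j < n)%N ->
     translate L (slice L j (nodes0 M)) = slice L j.+1 (nodesL M) /\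
     translate L (slice L j (nodesL M)) = slice L j.+1 (nodes0 M)).

End Mesh.

(* Main.v *)
From HB Require Import structures.
Require Import Defs.
From mathcomp Require Import all_boot all_order all_algebra.
From mathcomp Require Import all_classical all_reals all_analysis.
From mathcomp Require Import measurable_realfun lebesgue_integral lebesgue_Rintegral.
From mathcomp Require Import ring lra.

Set Implicit Arguments.
Unset Strict Implicit.
Unset Printing Implicit Defensive.

Import Order.TTheory GRing.Theory Num.Theory.
Import numFieldNormedType.Exports.

Local Open Scope classical_set_scope.
Local Open Scope ring_scope.

(** This is Cea's lemma for the discrete inf-sup condition.  For every discrete [v],

      |z - zh| <= |z - v| + |v - zh|,

    and the inf-sup condition bounds c1K |v - zh| by the supremum over discrete [m] of
    <A (v - zh), m> / |m|', where A = +-1/2 Id + K and |.|' is the dual norm.  Since A zh and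
    A z = g have the same pairing with discrete functions, A (v - zh) may be replaced by
    A (v - z); duality then bounds the supremum by |A (v - z)| <= |A| |v - z|, and the
    infimum over [v] gives the claim.

    The work lies in the functional analysis behind these few inequalities, because the
    norms are explicit integrals, infima and suprema.  They have their intended meaning only
    where the integrals are finite and the sets bounded:

    - the interpolation norm is a seminorm on the interpolation space ([interp_sqD],
      [interp_normD]), is finite on H^1 ([sub_interp_space]), dominates the L^2 norm
      ([interp_sq_embedding]) and does not increase under an operator that contracts both
      end spaces ([interp_sq_map]);

    - the functions of H^1 that vanish at 0 are the primitives of L^2 functions
      ([H10I_prim], [prim_H10I]).  This makes the weak derivative additive almost everywhere
      and shows that it commutes with the delay in K, gives Poincare's inequality, and
      contains the piecewise affine functions ([S1I_H10I]).  It rests on Fubini's theorem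
      ([weak_derivative_prim]), on the constancy of continuous functions with zero weak
      derivative ([weakly_constant_eq0]) and on Lebesgue differentiation ([prim_inj]).

    Consequently A is bounded on H^1/2 ([H12S_halfIdK]), so that its operator norm is a
    true supremum, the dual norm of an L^2 function is finite and the duality inequality
    holds ([pairing_dual]), and discrete functions belong to H^1/2 ([S1_H12S]). *)

(** * Interpolation by the quadratic K-functional *)

Section InterpolationTheory.
Context {R : realType} {V : zmodType}.
Variables (X Y : set V) (nX nY : V -> R).
Local Notation K := (Kfun_sq X nX nY).
Local Notation mu := (@lebesgue_measure R).
Local Notation I2 := (interp_sq X nX nY).
Local Notation N := (interp_norm X nX nY).
Implicit Types (t d C : R) (v w x : V).

Definition interp_integrand v t : \bar R := (t ^- 2 * K t v)%:E.

Lemma Kfun_sq_le t v x : X x -> K t v <= nY (v - x) ^+ 2 + t ^+ 2 * nX x ^+ 2.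
Proof.
move=> Xx.
have /ge_inf : has_lbound [set nY (v - y) ^+ 2 + t ^+ 2 * nX y ^+ 2 | y in X].
  by exists 0 => _ [y _ <-]; rewrite -exprMn addr_ge0 ?sqr_ge0.
by apply; exists x.
Qed.

Lemma Kfun_sq_ge m t v : X !=set0 ->
  (forall x, X x -> m <= nY (v - x) ^+ 2 + t ^+ 2 * nX x ^+ 2) -> m <= K t v.
Proof.
move=> [x0 Xx0] h; apply: lb_le_inf.
  by exists (nY (v - x0) ^+ 2 + t ^+ 2 * nX x0 ^+ 2); exists x0.
by move=> _ [x Xx <-]; exact: h.
Qed.

Hypothesis X0 : X 0.

Let Xne : X !=set0. Proof. by exists 0. Qed.

Lemma Kfun_sq_ge0 t v : 0 <= K t v.
Proof.
by apply: Kfun_sq_ge => // x _; rewrite -exprMn addr_ge0 ?sqr_ge0.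
Qed.

Lemma Kfun_sq_mono v s t : 0 <= s -> s <= t -> K s v <= K t v.
Proof.
move=> s0 st; apply: Kfun_sq_ge => // x Xx.
apply: (le_trans (Kfun_sq_le s v Xx)); rewrite lerD2l ler_wpM2r ?sqr_ge0//.
by rewrite lerXn2r ?nnegrE// (le_trans s0).
Qed.

(** The K-functional is nondecreasing in [t >= 0]; composing with [Num.max 0] makes it
    nondecreasing on the whole line, hence Borel. *)
Lemma measurable_interp_integrand v :
  measurable_fun `]0%R : R, +oo[ (interp_integrand v).
Proof.
apply/measurable_EFinP; apply: measurable_funM.
  apply: (eq_measurable_fun (fun t => (t^-1) ^+ 2)) => [t _|].
    by rewrite exprVn.
  apply: measurable_funX.
  apply: open_continuous_measurable_fun; first exact: interval_open.
  by move=> t /[!inE]/=; rewrite in_itv/= andbT => t0; apply: inv_continuous; rewrite gt_eqF.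
apply: (eq_measurable_fun (fun t => K (Num.max 0 t) v)) => [t|].
  by rewrite inE/= in_itv/= andbT => /ltW t0; rewrite (max_idPr t0).
apply: nondecreasing_measurable => // s t st.
apply: Kfun_sq_mono; first by rewrite le_max lexx.
by rewrite ge_max le_max lexx/= le_max st orbT.
Qed.

Lemma interp_integrand_ge0 v t : (0 <= interp_integrand v t)%E.
Proof. by rewrite lee_fin mulr_ge0 ?Kfun_sq_ge0 ?invr_ge0 ?sqr_ge0. Qed.

Lemma interp_sqE v :
  I2 v = ((2 / pi)%:E * \int[mu]_(t in `]0%R, +oo[) interp_integrand v t)%E.
Proof. by []. Qed.

Let pi2_ge0 : (0 <= (2 / pi : R)%:E)%E.
Proof. by rewrite lee_fin divr_ge0// pi_ge0. Qed.

Lemma interp_sq_ge0 v : (0 <= I2 v)%E.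
Proof.
by rewrite interp_sqE mule_ge0// integral_ge0// => t _; exact: interp_integrand_ge0.
Qed.

Lemma interp_norm_ge0 v : 0 <= N v.
Proof. exact: sqrtr_ge0. Qed.

Lemma interp_normE v : (I2 v < +oo)%E -> I2 v = (N v ^+ 2)%:E.
Proof.
move=> fv; rewrite sqr_sqrtr ?fine_ge0 ?interp_sq_ge0// fineK//.
by rewrite ge0_fin_numE// interp_sq_ge0.
Qed.

(** Interpolation of bounded operators: replacing the competitor [x] by [A x] multiplies
    the functional of [v] by at most [C], for every [t]. *)
Lemma interp_sq_map (A : V -> V) C v : 0 <= C ->
  (forall x, X x -> X (A x)) ->
  (forall x, X x -> nY (A v - A x) ^+ 2 <= C * nY (v - x) ^+ 2) ->
  (forall x, X x -> nX (A x) ^+ 2 <= C * nX x ^+ 2) ->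
  (I2 (A v) <= C%:E * I2 v)%E.
Proof.
move=> C0 AX AY AXX; rewrite !interp_sqE muleCA.
apply: lee_wpmul2l => //.
rewrite -ge0_integralZl//; last 2 first.
- exact: measurable_interp_integrand.
- by move=> t _; exact: interp_integrand_ge0.
apply: ge0_le_integral => //.
- by move=> t _; exact: interp_integrand_ge0.
- exact: measurable_interp_integrand.
- by apply: measurable_funeM; exact: measurable_interp_integrand.
move=> t; rewrite /= in_itv/= andbT => t0.
rewrite /interp_integrand -EFinM lee_fin mulrCA ler_wpM2l ?invr_ge0 ?exprn_ge0 ?(ltW t0)//.
have [C00|Cp] := eqVneq C 0.
  apply: (le_trans (Kfun_sq_le t (A v) (AX _ X0))).
  have := AY _ X0; have := AXX _ X0; rewrite C00 !mul0r => a b.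
  by rewrite -[leRHS]addr0 lerD// mulr_ge0_le0 ?sqr_ge0.
have {}Cp : 0 < C by rewrite lt_neqAle eq_sym Cp.
rewrite -ler_pdivrMl//; apply: Kfun_sq_ge => // x Xx.
rewrite ler_pdivrMl//; apply: (le_trans (Kfun_sq_le t (A v) (AX _ Xx))).
rewrite mulrDr lerD ?AY// (mulrCA C) ler_wpM2l ?sqr_ge0//; exact: AXX.
Qed.

(** The triangle inequality is first proved in this squared form, Young's inequality with
    a free parameter [d], because it passes through infima and integrals: adding the
    competitors of [v] and [w] gives one for [v + w]. *)
Lemma interp_sqD d v w : 0 < d ->
  (forall x y, X x -> X y -> X (x + y)) ->
  (forall x y, X x -> X y -> nY (v + w - (x + y)) ^+ 2 <=
     (1 + d) * nY (v - x) ^+ 2 + (1 + d^-1) * nY (w - y) ^+ 2) ->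
  (forall x y, X x -> X y -> nX (x + y) ^+ 2 <=
     (1 + d) * nX x ^+ 2 + (1 + d^-1) * nX y ^+ 2) ->
  (I2 (v + w) <= (1 + d)%:E * I2 v + (1 + d^-1)%:E * I2 w)%E.
Proof.
move=> d0 XD YD XXD; rewrite !interp_sqE !(muleCA _ (2 / pi)%:E) -ge0_muleDr; last 2 first.
- rewrite mule_ge0 ?lee_fin ?addr_ge0 ?(ltW d0)// integral_ge0// => t _.
  exact: interp_integrand_ge0.
- rewrite mule_ge0 ?lee_fin ?addr_ge0 ?invr_ge0 ?(ltW d0)// integral_ge0// => t _.
  exact: interp_integrand_ge0.
apply: lee_wpmul2l => //.
have d1 : 0 < 1 + d by rewrite addr_gt0.
have d2 : 0 < 1 + d^-1 by rewrite addr_gt0// invr_gt0.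
have Zge0 c u t : 0 < c -> (0 <= c%:E * interp_integrand u t)%E.
  by move=> c0; rewrite mule_ge0 ?interp_integrand_ge0// lee_fin ltW.
rewrite -!ge0_integralZl//; try (by move=> t _; exact: interp_integrand_ge0);
  try exact: measurable_interp_integrand; try (by rewrite lee_fin ltW).
rewrite -ge0_integralD//; try (by move=> t _; exact: Zge0);
  try (by apply: measurable_funeM; exact: measurable_interp_integrand).
apply: ge0_le_integral => //.
- by move=> t _; exact: interp_integrand_ge0.
- exact: measurable_interp_integrand.
- by apply: emeasurable_funD; apply: measurable_funeM; exact: measurable_interp_integrand.
move=> t; rewrite /= in_itv/= andbT => t0.
rewrite /interp_integrand -!EFinM -EFinD lee_fin.
rewrite (mulrCA (1 + d)) (mulrCA (1 + d^-1)) -mulrDr ler_wpM2l ?invr_ge0 ?exprn_ge0 ?(ltW t0)//.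
rewrite -lerBlDl -ler_pdivrMl//; apply: Kfun_sq_ge => // y Xy.
rewrite ler_pdivrMl// lerBlDl -lerBlDr -ler_pdivrMl//; apply: Kfun_sq_ge => // x Xx.
rewrite ler_pdivrMl// lerBlDr; apply: (le_trans (Kfun_sq_le t _ (XD _ _ Xx Xy))).
have := lerD (YD _ _ Xx Xy) (ler_wpM2l (sqr_ge0 t) (XXD _ _ Xx Xy)).
move=> /le_trans; apply; rewrite le_eqVlt; apply/orP; left; apply/eqP; ring.
Qed.

(** The competitors [0] and [v] bound K by both |v|_Y^2 and t^2 |v|_X^2, so t^-2 K is
    dominated by a multiple of 1 / (1 + t^2), whose integral is an arctangent. *)
Lemma sub_interp_space v : X v -> Y v -> nY 0 = 0 -> nX 0 = 0 -> interp_space X Y nX nY v.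
Proof.
move=> Xv Yv nY0 nX0; split=> //; rewrite interp_sqE.
rewrite lte_mul_pinfty//.
pose C := 2 * (nY v ^+ 2 + nX v ^+ 2).
have C0 : 0 <= C by rewrite mulr_ge0// addr_ge0 ?sqr_ge0.
have mD : measurable_fun `]0%R : R, +oo[ (fun t : R => (oneDsqr t)^-1%:E).
  apply/measurable_EFinP; apply: measurable_funTS.
  by apply: continuous_measurable_fun; exact: continuous_oneDsqrV.
have p0 (t : R) : (0 <= (oneDsqr t)^-1%:E)%E.
  by rewrite lee_fin invr_ge0// (le_trans ler01)// oneDsqr_ge1.
apply: (@le_lt_trans _ _ (C%:E * \int[mu]_(t in `]0%R, +oo[) (oneDsqr t)^-1%:E)%E); last first.
  rewrite lte_mul_pinfty//.
  rewrite (integral_itv_obnd_cbnd mD).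
  by rewrite integral0y_oneDsqr ltry.
rewrite -ge0_integralZl//.
apply: ge0_le_integral => //.
- by move=> t _; exact: interp_integrand_ge0.
- exact: measurable_interp_integrand.
- exact: measurable_funeM.
move=> t; rewrite /= in_itv/= andbT => t0.
rewrite -EFinM lee_fin ler_pdivlMr; last by rewrite (lt_le_trans ltr01)// oneDsqr_ge1.
rewrite -mulrA ler_pdivrMl ?exprn_gt0//.
have Kv := Kfun_sq_le t v Xv; rewrite subrr nY0 expr0n/= add0r in Kv.
have K0 := Kfun_sq_le t v X0; rewrite subr0 nX0 expr0n/= mulr0 addr0 in K0.
have Kge := Kfun_sq_ge0 t v.
rewrite /oneDsqr /C.
have := sqr_ge0 (nY v); have := sqr_ge0 (nX v).
have := sqr_ge0 t.
move: (t ^+ 2) (nY v ^+ 2) (nX v ^+ 2) (K t v) Kv K0 Kge => s a b k.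
move=> ? ? ? ? ? ?.
nra.
Qed.

(** The hypothesis says that K(C, v) >= |v|_Y^2 / 2, which by monotonicity persists for
    [t >= C]; integrating t^-2 over [C, 2 * C] is then enough. *)
Lemma interp_sq_embedding C v : 0 < C ->
  (forall x, X x -> nY v ^+ 2 <= 2 * (nY (v - x) ^+ 2 + C ^+ 2 * nX x ^+ 2)) ->
  ((nY v ^+ 2)%:E <= (4 * pi * C)%:E * I2 v)%E.
Proof.
move=> C0 h.
have Kb t : C <= t -> nY v ^+ 2 / 2 <= K t v.
  move=> Ct; apply: (@le_trans _ _ (K C v)); last by apply: Kfun_sq_mono => //; exact: ltW.
  by apply: Kfun_sq_ge => // x Xx; rewrite ler_pdivrMr// mulrC; exact: h.
rewrite interp_sqE muleA -EFinM.
have -> : 4 * pi * C * (2 / pi) = 8 * C.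
  by have := lt0r_neq0 (pi_gt0 R); move: (pi : R) => p p0; field.
have sub : `[C, (2 * C)%R] `<=` `]0%R, +oo[.
  by move=> t; rewrite /= !in_itv/= andbT => /andP[Ct _]; exact: lt_le_trans Ct.
(* Lower bound of the integrand on [C, 2 * C], an interval of length [C]; whence the constant:
   2 / pi * C / (4 * C^2) / 2 = 1 / (4 * pi * C). *)
pose m : R := (2 * C) ^- 2 * (nY v ^+ 2 / 2).
apply: (@le_trans _ _ ((8 * C)%:E * \int[mu]_(t in `[C, (2 * C)%R]) m%:E)%E); last first.
  apply: lee_wpmul2l; first by rewrite lee_fin mulr_ge0// ltW.
  apply: (@le_trans _ _ (\int[mu]_(t in `[C, (2 * C)%R]) interp_integrand v t)%E); last first.
    apply: ge0_subset_integral => //; first exact: measurable_interp_integrand.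
    by move=> t _; exact: interp_integrand_ge0.
  apply: ge0_le_integral => //.
  - by move=> t _; rewrite lee_fin mulr_ge0 ?divr_ge0 ?invr_ge0 ?sqr_ge0.
  - apply: measurable_funS sub _ => //; exact: measurable_interp_integrand.
  move=> t; rewrite /= in_itv/= => /andP[Ct t2].
  rewrite lee_fin ler_pM ?divr_ge0 ?invr_ge0 ?sqr_ge0//.
    have tp : 0 < t by exact: lt_le_trans Ct.
    have Cp : 0 < 2 * C by rewrite mulr_gt0.
    rewrite lef_pV2 ?posrE ?(exprn_gt0 _ tp) ?(exprn_gt0 _ Cp)//.
    by apply: lerXn2r; rewrite ?nnegrE ?(ltW tp) ?(ltW Cp).
  exact: Kb.
rewrite integral_cst//= lebesgue_measure_itv/= lte_fin.
have -> : C < 2 * C by lra.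
rewrite -EFinB -!EFinM lee_fin le_eqVlt; apply/orP; left; apply/eqP.
by rewrite /m; field; rewrite gt_eqF.
Qed.

End InterpolationTheory.

(** For norms [a], [b] the bound (1 + d) a^2 + (1 + 1/d) b^2 is smallest at d = b / a,
    where it is (a + b)^2.  Both are enlarged by [e / 2] to keep the quotient meaningful. *)
Lemma interp_normD (R : realType) (V : zmodType) (X : set V) (nX nY : V -> R) v w :
  X 0 -> (interp_sq X nX nY v < +oo)%E -> (interp_sq X nX nY w < +oo)%E ->
  (forall d, 0 < d -> (interp_sq X nX nY (v + w) <=
     (1 + d)%:E * interp_sq X nX nY v + (1 + d^-1)%:E * interp_sq X nX nY w)%E) ->
  (interp_sq X nX nY (v + w) < +oo)%E /\
  interp_norm X nX nY (v + w) <= interp_norm X nX nY v + interp_norm X nX nY w.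
Proof.
move=> X0 fv fw h; have Ev := interp_normE X0 fv; have Ew := interp_normE X0 fw.
have fvw : (interp_sq X nX nY (v + w) < +oo)%E.
  by apply: (le_lt_trans (h 1 ltr01)); rewrite Ev Ew -!EFinM -EFinD ltry.
split => //; have Evw := interp_normE X0 fvw.
have := interp_norm_ge0 X nX nY v; have := interp_norm_ge0 X nX nY w.
have := interp_norm_ge0 X nX nY (v + w).
move: Ev Ew Evw h.
move: (interp_norm X nX nY v) (interp_norm X nX nY w) (interp_norm X nX nY (v + w)).
move=> a b c -> -> -> h c0 b0 a0; apply/ler_addgt0Pr => e e0.
pose a' := a + e / 2; pose b' := b + e / 2.
have e2 : 0 < e / 2 by rewrite divr_gt0.
have a'0 : 0 < a' by rewrite ltr_wpDl.
have b'0 : 0 < b' by rewrite ltr_wpDl.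
have /h : 0 < b' / a' by rewrite divr_gt0.
rewrite -!EFinM -EFinD lee_fin invf_div => {}h.
have {}h : c ^+ 2 <= (a' + b') ^+ 2.
  apply: (le_trans h).
  have -> : (a' + b') ^+ 2 = (1 + b' / a') * a' ^+ 2 + (1 + a' / b') * b' ^+ 2.
    by field; rewrite !gt_eqF.
  have mono x : 0 <= x -> x ^+ 2 <= (x + e / 2) ^+ 2.
    by move=> x0; apply: lerXn2r; rewrite ?nnegrE ?addr_ge0 ?lerDl ?(ltW e2).
  by apply: lerD; apply: ler_wpM2l; rewrite ?mono// addr_ge0// divr_ge0// ltW.
have -> : a + b + e = a' + b' by rewrite /a' /b'; field.
have ab0 : 0 <= a' + b' by apply: addr_ge0; exact: ltW.
by move: h; rewrite ler_pXn2r ?nnegrE.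
Qed.

Lemma interp_norm_le (R : realType) (V : zmodType) (X : set V) (nX nY : V -> R) u v :
  X 0 -> (interp_sq X nX nY v < +oo)%E -> (interp_sq X nX nY u <= interp_sq X nX nY v)%E ->
  interp_norm X nX nY u <= interp_norm X nX nY v.
Proof.
move=> X0 fv le; apply: ler_wsqrtr; apply: fine_le => //.
- by rewrite ge0_fin_numE ?(le_lt_trans le)// interp_sq_ge0.
- by rewrite ge0_fin_numE// interp_sq_ge0.
Qed.

Lemma interp_sq_eq0 (R : realType) (V : zmodType) (X : set V) (nX nY : V -> R) v :
  X 0 -> nX 0 = 0 -> nY v = 0 -> interp_sq X nX nY v = 0%E.
Proof.
move=> X0 nX0 nY0; rewrite interp_sqE integral0_eq ?mule0// => t _.
rewrite /interp_integrand; have := Kfun_sq_le nX nY t v X0.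
rewrite subr0 nX0 nY0 expr0n/= mulr0 addr0 => K0.
by rewrite (_ : Kfun_sq X nX nY t v = 0) ?mulr0//; apply/eqP; rewrite eq_le K0 Kfun_sq_ge0.
Qed.

(** * Square-integrable functions on (0, T) *)

Lemma sqr_normE (R : realDomainType) (x : R) : `|x| ^+ 2 = x ^+ 2.
Proof. by rewrite -normrX ger0_norm ?sqr_ge0. Qed.

Section L2.
Context {R : realType}.
Variable T : R.
Local Notation mu := (@lebesgue_measure R).
Local Notation I := (`]0, T[%classic : set R).
Implicit Types (f g h : R -> R) (a b c : R).

Definition ipI f g : R := \int[mu]_(t in I) (f t * g t).

(** The form in which square integrability is used: on the interval itself, without the
    extension by zero. *)
Lemma L2IP f : L2I T f <->
  measurable_fun I f /\ mu.-integrable I (EFin \o (fun t => f t ^+ 2)).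
Proof.
have E : (fun t => ((f \_ I) t) ^+ 2) = (fun t => f t ^+ 2) \_ I.
  by apply/funext => t; rewrite !patchE; case: ifP => // _; rewrite expr0n.
have E2 : EFin \o (fun t => ((f \_ I) t) ^+ 2) = (EFin \o (fun t => f t ^+ 2)) \_ I.
  by rewrite E restrict_EFin.
split=> [Lf|[mf sf]].
  split.
    apply/(measurable_restrictT f) => //.
    by move: Lf; rewrite /L2I inE => /andP[]; rewrite inE.
  by rewrite integrable_mkcond// -E2; exact: Lfun2_integrable_sqr.
rewrite /L2I inE; apply/andP; split; rewrite inE/=.
  by apply/(measurable_restrictT f).
move: sf; rewrite integrable_mkcond// -E2 => /integrableP[_ h].
rewrite /finite_norm unlock poweR_lty//; move: h; apply: le_lt_trans.
rewrite le_eqVlt; apply/orP; left; apply/eqP; apply: eq_integral => t _ /=.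
by rewrite normrX powR_mulrn.
Qed.

Lemma L2I_measurable f : L2I T f -> measurable_fun I f.
Proof. by case/L2IP. Qed.

Lemma L2I_integrableM f g : L2I T f -> L2I T g ->
  mu.-integrable I (EFin \o (fun t => f t * g t)).
Proof.
case/L2IP => mf sf /L2IP [mg sg].
apply: (@le_integrable _ _ _ mu I (measurable_itv _) _
  (EFin \o (fun t => f t ^+ 2 + g t ^+ 2))) => //.
- by apply/measurable_EFinP; exact: measurable_funM.
- move=> t _ /=; rewrite lee_fin [leRHS]ger0_norm ?addr_ge0 ?sqr_ge0//.
  rewrite normrM -[in leRHS](sqr_normE (f t)) -[in leRHS](sqr_normE (g t)).
  have := sqr_ge0 (`|f t| - `|g t|); have := normr_ge0 (f t); have := normr_ge0 (g t).
  by move: `|f t| `|g t| => x y; nra.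
- exact: (integrableD _ sf sg).
Qed.

Lemma L2I_dominated f g h : L2I T f -> L2I T g -> measurable_fun I h ->
  (forall t, I t -> h t ^+ 2 <= f t ^+ 2 + g t ^+ 2) -> L2I T h.
Proof.
move=> /L2IP [mf sf] /L2IP [mg sg] mh le; apply/L2IP; split => //.
apply: (@le_integrable _ _ _ mu I (measurable_itv _) _
  (EFin \o (fun t => f t ^+ 2 + g t ^+ 2))) => //.
- by apply/measurable_EFinP; exact: measurable_funX.
- by move=> t It /=; rewrite lee_fin !ger0_norm ?addr_ge0 ?sqr_ge0//; exact: le.
- exact: (integrableD _ sf sg).
Qed.

Lemma L2I_cst c : L2I T (cst c).
Proof.
apply/L2IP; split => //.
rewrite (_ : _ \o _ = cst (c ^+ 2)%:E)//.
apply/integrableP; split => //; rewrite integral_cst//= lebesgue_measure_itv/=.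
by case: ifP => _; rewrite ?mule0 ?ltry// -EFinB -EFinM ltry.
Qed.

Lemma L2I_bounded c f : measurable_fun I f -> (forall t, I t -> `|f t| <= c) -> L2I T f.
Proof.
move=> mf fc; apply: (L2I_dominated (L2I_cst c) (L2I_cst 0)) => // t It.
rewrite /= expr0n addr0 -sqr_normE lerXn2r ?nnegrE ?fc//.
exact: le_trans (fc t It).
Qed.

Lemma L2I_integrable f : L2I T f -> mu.-integrable I (EFin \o f).
Proof.
move=> /L2I_integrableM /(_ (L2I_cst 1)); apply: eq_integrable => // t _ /=.
by rewrite mulr1.
Qed.

Lemma L2I_lin a b f g : L2I T f -> L2I T g -> L2I T (fun t => a * f t + b * g t).
Proof.
move=> Lf Lg.
have LZ c h : L2I T h -> L2I T (fun t => c * h t).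
  case/L2IP => mh sh; apply/L2IP; split; first exact: measurable_funM.
  rewrite (_ : _ \o _ = (fun t => (c ^+ 2)%:E * (h t ^+ 2)%:E)%E).
    exact: integrableZl.
  by apply/funext => t /=; rewrite exprMn.
apply: (L2I_dominated (LZ 2 _ (LZ a _ Lf)) (LZ 2 _ (LZ b _ Lg))).
  by apply: measurable_funD; apply: measurable_funM => //; exact: L2I_measurable.
move=> t _; have := sqr_ge0 (a * f t - b * g t).
have := sqr_ge0 (a * f t); have := sqr_ge0 (b * g t).
by move: (a * f t) (b * g t) => x y; nra.
Qed.

Lemma ipC f g : ipI f g = ipI g f.
Proof. by apply: eq_Rintegral => t _; rewrite mulrC. Qed.

Lemma ipI_linl a b f g h : L2I T f -> L2I T g -> L2I T h ->
  ipI (fun t => a * f t + b * g t) h = a * ipI f h + b * ipI g h.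
Proof.
move=> Lf Lg Lh; have If := L2I_integrableM Lf Lh; have Ig := L2I_integrableM Lg Lh.
rewrite /ipI -!RintegralZl// -RintegralD//.
- by apply: eq_Rintegral => t _; ring.
- by rewrite (_ : _ \o _ = (fun t => a%:E * (f t * h t)%:E)%E)//; exact: integrableZl.
- by rewrite (_ : _ \o _ = (fun t => b%:E * (g t * h t)%:E)%E)//; exact: integrableZl.
Qed.

Lemma ipI_linr a b f g h : L2I T f -> L2I T g -> L2I T h ->
  ipI h (fun t => a * f t + b * g t) = a * ipI h f + b * ipI h g.
Proof. by move=> Lf Lg Lh; rewrite ipC ipI_linl// !(ipC h). Qed.

Lemma ipI_ge0 f : 0 <= ipI f f.
Proof. by apply: Rintegral_ge0 => t _; rewrite -expr2 sqr_ge0. Qed.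

(** The difference of the two sides is, up to the factor d^-1, the square norm of d f - g. *)
Lemma ipI_young d f g : 0 < d -> L2I T f -> L2I T g ->
  ipI (fun t => f t + g t) (fun t => f t + g t) <=
  (1 + d) * ipI f f + (1 + d^-1) * ipI g g.
Proof.
move=> d0 Lf Lg.
pose r := d.
have : 0 <= ipI (fun t => r * f t + (-1) * g t) (fun t => r * f t + (-1) * g t).
  exact: ipI_ge0.
have -> : (fun t => f t + g t) = (fun t => 1 * f t + 1 * g t).
  by apply/funext => t; rewrite !mul1r.
have L1 := L2I_lin 1 1 Lf Lg; have L2 := L2I_lin r (-1) Lf Lg.
rewrite !ipI_linl// !ipI_linr// (ipC g f) /r.
move: (ipI f f) (ipI g g) (ipI f g) => x y z h.
rewrite -subr_ge0.
have -> : (1 + d) * x + (1 + d^-1) * y - (1 * (1 * x + 1 * z) + 1 * (1 * z + 1 * y))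
  = d^-1 * (d * (d * x + -1 * z) + -1 * (d * z + -1 * y)).
  by field; rewrite gt_eqF.
by rewrite mulr_ge0// invr_ge0 ltW.
Qed.

(** A substitute for the Cauchy-Schwarz inequality that needs no square root; the optimal
    [s] is chosen by each user. *)
Lemma ipI_le s f g : 0 < s -> L2I T f -> L2I T g ->
  2 * `|ipI f g| <= s * ipI f f + s^-1 * ipI g g.
Proof.
move=> s0 Lf Lg.
have h e : e = 1 \/ e = -1 -> 2 * (e * ipI f g) <= s * ipI f f + s^-1 * ipI g g.
  move=> he; have e2 : e ^+ 2 = 1 by case: he => ->; rewrite ?expr1n ?sqrrN ?expr1n.
  have := ipI_ge0 (fun t => s * f t + (- e) * g t).
  rewrite !ipI_linl//; last exact: L2I_lin.
  rewrite !ipI_linr// (ipC g f).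
  move: (ipI f f) (ipI g g) (ipI f g) => x y z hh; rewrite -subr_ge0.
  have -> : s * x + s^-1 * y - 2 * (e * z) =
     s^-1 * (s * (s * x + - e * z) + - e * (s * z + - e * y)) + (1 - e ^+ 2) * (s^-1 * y).
    by field; rewrite gt_eqF.
  by rewrite e2 subrr mul0r addr0 mulr_ge0// invr_ge0 ltW.
by case: ger0P => _; [rewrite -[ipI f g]mul1r | rewrite -mulN1r]; apply: h; [left|right].
Qed.

Lemma ipI_aeE f f' g : L2I T f -> L2I T f' -> L2I T g -> ae_eq mu I f f' ->
  ipI f g = ipI f' g.
Proof.
move=> Lf Lf' Lg ff'; rewrite /ipI /Rintegral; congr fine.
apply: ae_eq_integral => //.
- by apply/measurable_EFinP; apply: measurable_funM; exact: L2I_measurable.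
- by apply/measurable_EFinP; apply: measurable_funM; exact: L2I_measurable.
by apply: filterS ff' => t ht It; rewrite ht.
Qed.

Lemma ip0_ae f : L2I T f -> ipI f f = 0 -> ae_eq mu I f (cst 0).
Proof.
move=> Lf; have := L2I_integrableM Lf Lf; case/L2IP: Lf => mf sf ii.
rewrite /ipI /Rintegral => h.
have : (\int[mu]_(t in I) `|(f t * f t)%:E| = 0)%E.
  have -> : (\int[mu]_(t in I) `|(f t * f t)%:E| = \int[mu]_(t in I) (f t * f t)%:E)%E.
    by apply: eq_integral => t _; rewrite gee0_abs// lee_fin -expr2 sqr_ge0.
  by rewrite -[LHS]fineK ?h//; exact: integrable_fin_num.
move/ae_eq_integral_abs => H.
have /H : measurable_fun I (fun t => (f t * f t)%:E).
  by apply/measurable_EFinP; exact: measurable_funM.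
move=> /(_ (measurable_itv _)); apply: filterS => t ht It.
by have /eqP := ht It; rewrite eqe mulf_eq0 orbb => /eqP.
Qed.
End L2.

(** * Translation and delay *)

Section Translation.
Context {R : realType}.
Variable L : R.
Local Notation mu := (@lebesgue_measure R).

Definition translation (t : measurableTypeR R) : measurableTypeR R := (t : R) - L.

Lemma measurable_translation : measurable_fun [set: measurableTypeR R] translation.
Proof. by apply: measurable_funB. Qed.

HB.instance Definition _ := isMeasurableFun.Build _ _ _ _ translation measurable_translation.

(** By uniqueness of the Lebesgue measure it suffices to compare interval lengths. *)
Lemma lebesgue_measure_translate (A : set R) : measurable A ->
  pushforward mu translation A = mu A.
Proof.
move=> mA; apply/esym.
apply: (lebesgue_measure_unique (mu := pushforward mu translation)) => //= _ [[a b]] _ <-.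
rewrite /pushforward/=.
have -> : translation @^-1` `]a, b] = `]a + L, b + L]%classic.
  by apply/seteqP; split => t /=; rewrite !in_itv/= /translation ltrBrDr lerBlDr.
rewrite !lebesgue_measure_itv/= !lte_fin ltrD2r; case: ifP => // _.
by rewrite -!EFinB; congr EFin; ring.
Qed.

Lemma ge0_integral_translate (f : R -> \bar R) : measurable_fun [set: R] f ->
  (forall t, (0 <= f t)%E) -> (\int[mu]_t f (t - L)%R = \int[mu]_t f t)%E.
Proof.
move=> mf f0.
have := ge0_integral_pushforward measurable_translation mu measurableT mf (fun t _ => f0 t).
rewrite preimage_setT => <-.
by apply: eq_measure_integral => //= A mA AS; exact: lebesgue_measure_translate.
Qed.

Lemma integral_translate (f : R -> \bar R) : mu.-integrable [set: R] f ->
  (\int[mu]_t f (t - L)%R = \int[mu]_t f t)%E.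
Proof.
move=> fi; have := fi; case/integrableP => mf ff.
have fi' : mu.-integrable (translation @^-1` setT) (f \o translation).
  rewrite preimage_setT; apply/integrableP; split.
    by apply: (measurableT_comp mf); exact: measurable_translation.
  have mabs := measurableT_comp (@abse_measurable R setT) mf.
  by have /= -> := @ge0_integral_translate (abse \o f) mabs (fun t => abse_ge0 (f t)).
have := integral_pushforward measurable_translation mf fi' measurableT.
rewrite preimage_setT => <-.
by apply: eq_measure_integral => //= A mA AS; exact: lebesgue_measure_translate.
Qed.

Lemma negligible_translate (A : set R) : mu.-negligible A ->
  mu.-negligible (translation @^-1` A).
Proof.
move=> [B [mB B0 AB]]; exists (translation @^-1` B); split.
- by rewrite -[X in measurable X]setTI; exact: measurable_translation.
- by rewrite -B0; exact: lebesgue_measure_translate.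
- by move=> t /AB.
Qed.

End Translation.

Section Delay.
Context {R : realType}.
Variables (T L : R).
Hypotheses (L0 : 0 < L).
Local Notation mu := (@lebesgue_measure R).
Local Notation I := (`]0, T[%classic : set R).
Local Notation ipI := (ipI T).
Implicit Types (f g h : R -> R) (a b c : R).

Definition delay f t : R := ext0 f (t - L).

(** On (0, T) a delay only looks into the past, so extension by zero on the left of 0 may be
    replaced by extension by zero outside (0, T), for which translation invariance on the
    whole line applies. *)
Lemma delay_patch f t : I t -> delay f t = (f \_ I) (t - L).
Proof.
rewrite /= in_itv/= => /andP[t0 tT]; rewrite /delay /ext0 patchE.
case: ifPn => tL.
  rewrite mem_set//= in_itv/= tL/= (lt_trans _ tT)// ltrBlDr ltrDl//.
rewrite memNset//= in_itv/= (negbTE tL).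
by [].
Qed.

Lemma measurable_delay f : measurable_fun I f -> measurable_fun I (delay f).
Proof.
move=> mf; apply: (eq_measurable_fun ((f \_ I) \o translation L)).
  by move=> t /set_mem It; rewrite delay_patch.
apply: measurable_funTS; apply: measurableT_comp; last exact: measurable_translation.
by apply/(measurable_restrictT f).
Qed.

Lemma delay_sq f : measurable_fun I f ->
  (\int[mu]_(t in I) (delay f t ^+ 2)%:E <= \int[mu]_(t in I) (f t ^+ 2)%:E)%E.
Proof.
move=> mf; have mfI : measurable_fun setT (f \_ I) by apply/(measurable_restrictT f).
have -> : (\int[mu]_(t in I) (delay f t ^+ 2)%:E =
           \int[mu]_(t in I) ((f \_ I) (t - L) ^+ 2)%:E)%E.
  by apply: eq_integral => t /set_mem It; rewrite delay_patch.
have m2 : measurable_fun setT (fun t => ((f \_ I) t ^+ 2)%:E).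
  by apply/measurable_EFinP; exact: measurable_funX.
have p2 t : (0 <= ((f \_ I) t ^+ 2)%:E)%E by rewrite lee_fin sqr_ge0.
apply: (@le_trans _ _ (\int[mu]_t ((f \_ I) (t - L) ^+ 2)%:E)%E).
  apply: ge0_subset_integral => //.
  apply/measurable_EFinP; apply: measurable_funX.
  exact: (measurableT_comp mfI (measurable_translation L)).
rewrite (ge0_integral_translate L m2)// [leRHS]integral_mkcond.
rewrite le_eqVlt; apply/orP; left; apply/eqP.
apply: eq_integral => t _; rewrite !patchE; case: ifP => // _; rewrite expr0n//.
Qed.

Lemma L2I_delay f : L2I T f -> L2I T (delay f).
Proof.
case/L2IP => mf sf; apply/L2IP; split; first exact: measurable_delay.
apply/integrableP; split.
  by apply/measurable_EFinP; apply: measurable_funX; exact: measurable_delay.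
case/integrableP: sf => _; apply: le_lt_trans.
under eq_integral do rewrite gee0_abs ?lee_fin ?sqr_ge0//.
under [leRHS]eq_integral do rewrite gee0_abs ?lee_fin ?sqr_ge0//.
exact: delay_sq.
Qed.

Lemma ipI_delay f : L2I T f -> ipI (delay f) (delay f) <= ipI f f.
Proof.
move=> Lf; have Ld := L2I_delay Lf.
apply: fine_le; [exact: (integrable_fin_num _ (L2I_integrableM Ld Ld))|
  exact: (integrable_fin_num _ (L2I_integrableM Lf Lf))|].
exact: delay_sq (L2I_measurable Lf).
Qed.

Definition prim f t : R := \int[mu]_(s in `]0, t[) f s.

(** This is where the initial condition enters: a primitive vanishing at 0 stays a primitive
    when it is delayed and extended by zero. *)
Lemma prim_delay g t : L2I T g -> I t -> prim (delay g) t = delay (prim g) t.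
Proof.
move=> Lg It; have := It; rewrite /= in_itv/= => /andP[t0 tT].
have gI : mu.-integrable setT (EFin \o (g \_ I)).
  rewrite -restrict_EFin; apply/integrable_restrict => //.
  by rewrite setTI; exact: L2I_integrable.
have D s : I s -> `]0, s[%classic `<=` I.
  rewrite /= in_itv/= => /andP[_ sT] x; rewrite /= !in_itv/= => /andP[-> /lt_trans]; exact.
have -> : prim (delay g) t = \int[mu]_(s in `]0, t[) (g \_ I) (s - L).
  by apply: eq_Rintegral => s /set_mem /(D _ It) Is; rewrite delay_patch.
have -> : delay (prim g) t = prim g (t - L).
  rewrite /delay /ext0; case: ifPn => // tL; rewrite /prim.
  suff -> : `]0, (t - L)[%classic = set0 by rewrite Rintegral_set0.
  apply/seteqP; split => // s /=; rewrite in_itv/= => /andP[s0 /(lt_trans s0)].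
  by rewrite (negbTE tL).
pose G := (g \_ `]0, t - L[).
have -> : prim g (t - L) = \int[mu]_s G s by rewrite /prim Rintegral_mkcond.
have sub : `]0, t - L[%classic `<=` I.
  move=> s; rewrite /= !in_itv/= => /andP[-> /lt_trans]; apply.
  by rewrite ltrBlDr (lt_trans tT)// ltrDl.
have GI : mu.-integrable setT (EFin \o G).
  rewrite /G -restrict_EFin; apply/integrable_restrict => //.
  rewrite setTI; apply: integrableS (L2I_integrable Lg) => //.
rewrite [RHS]/Rintegral -(integral_translate L GI) -/(Rintegral _ _ _) Rintegral_mkcond.
apply: eq_Rintegral => s _; rewrite /= /G !patchE.
rewrite !mem_setE !in_itv/= subr_gt0 ltrD2r.
have [st|] := boolP (s < t); last by rewrite !andbF.
have [Ls|] := boolP (L < s) => /=; last by case: ifP.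
have -> : s - L < T by rewrite ltrBlDr (lt_trans st)// (lt_trans tT)// ltrDl.
by rewrite (lt_trans L0 Ls).
Qed.

Lemma ae_eq_delay f g : ae_eq mu I f g -> ae_eq mu I (delay f) (delay g).
Proof.
move=> fg; apply: (negligibleS _ (negligible_translate L fg)) => t /=.
move=> /not_implyP[It]; rewrite !delay_patch// => h; apply/not_implyP.
by move: h; rewrite !patchE; case: ifPn => [/set_mem ? ?|//]; split.
Qed.

End Delay.

(** * Primitives *)

Section Prim.
Context {R : realType}.
Variable T : R.
Hypothesis T0 : 0 < T.
Local Notation mu := (@lebesgue_measure R).
Local Notation I := (`]0, T[%classic : set R).
Local Notation ipI := (ipI T).
Implicit Types (f g h : R -> R) (a b c : R).

Lemma L2I_continuous f : {within `[0, T], continuous f} -> L2I T f.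
Proof.
move=> cf.
have sub : I `<=` `[0, T] by apply: subset_itv_oo_cc.
have cf2 : {within `[0, T], continuous (fun t => f t ^+ 2)}.
  by move=> t; apply: continuousM; exact: cf.
have := continuous_compact_integrable (@segment_compact R 0 T) cf.
have := continuous_compact_integrable (@segment_compact R 0 T) cf2.
move=> i2 i1; apply/L2IP; split.
  apply: (measurable_funS _ sub) => //; apply/measurable_EFinP.
  by case/integrableP: i1.
by apply: (@integrableS _ _ _ mu `[0, T]%classic I) => //.
Qed.

Lemma sub_itv0 t : t <= T -> `]0, t[%classic `<=` I.
Proof. by move=> tT s; rewrite /= !in_itv/= => /andP[-> /lt_le_trans]; apply. Qed.

Lemma integrable_prim g t : L2I T g -> t <= T -> mu.-integrable `]0, t[ (EFin \o g).
Proof.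
by move=> /L2I_integrable gi tT; apply: (@integrableS _ _ _ mu I) => //; exact: sub_itv0.
Qed.

Lemma prim0 g t : t <= 0 -> prim g t = 0.
Proof.
move=> t0; rewrite /prim (_ : `]0, t[%classic = set0) ?Rintegral_set0//.
apply/seteqP; split => // s /=; rewrite in_itv/= => /andP[s0 /(lt_trans s0)].
by rewrite ltNge t0.
Qed.

Lemma integrable_patch g : L2I T g -> mu.-integrable setT (EFin \o (g \_ I)).
Proof.
move=> Lg; rewrite -restrict_EFin; apply/integrable_restrict => //.
by rewrite setTI; exact: L2I_integrable.
Qed.

Lemma prim_parameterized g t : L2I T g -> t <= T ->
  prim g t = parameterized_integral mu 0 t (g \_ I).
Proof.
move=> Lg tT; rewrite /prim /parameterized_integral.
have int (b : set R) : measurable b -> mu.-integrable b (EFin \o (g \_ I)).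
  by move=> mb; apply: (@integrableS _ _ _ mu setT) => //; exact: integrable_patch.
rewrite -Rintegral_itv_obnd_cbnd; last exact: int.
rewrite -Rintegral_itv_bndo_bndc; last exact: int.
by apply: eq_Rintegral => s /set_mem /(sub_itv0 tT) Is; rewrite patchE mem_set.
Qed.

Lemma prim_continuous g : L2I T g -> {within `[0, T], continuous (prim g)}.
Proof.
move=> Lg.
have : {within `[0, T], continuous (fun t => parameterized_integral mu 0 t (g \_ I))}.
  apply: parameterized_integral_continuous; first exact: ltW.
  by apply: (@integrableS _ _ _ mu setT) => //; exact: integrable_patch.
apply: subspace_eq_continuous => t /set_mem; rewrite /= in_itv/= => /andP[_ tT].
by rewrite /from_subspace prim_parameterized.
Qed.

Lemma L2I_prim g : L2I T g -> L2I T (prim g).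
Proof. by move=> /prim_continuous /L2I_continuous. Qed.

Lemma prim_lin a b f g t : L2I T f -> L2I T g -> t <= T ->
  prim (fun s => a * f s + b * g s) t = a * prim f t + b * prim g t.
Proof.
move=> Lf Lg tT; have If := integrable_prim Lf tT; have Ig := integrable_prim Lg tT.
rewrite /prim -!RintegralZl// -RintegralD//.
- by rewrite (_ : _ \o _ = (fun t => a%:E * (f t)%:E)%E)//; exact: integrableZl.
- by rewrite (_ : _ \o _ = (fun t => b%:E * (g t)%:E)%E)//; exact: integrableZl.
Qed.

(** The Cauchy-Schwarz inequality for [g] against the constant [prim g t] on (0, t), in the
    form [ipI_le] with [s := T]. *)
Lemma prim_sq_le g t : L2I T g -> I t -> prim g t ^+ 2 <= T * ipI g g.
Proof.
move=> Lg; rewrite /= in_itv/= => /andP[t0 tT].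
pose m := prim g t; pose J := `]0, t[%classic : set R.
pose f := (fun s => m * \1_J s) : R -> R.
have Lf : L2I T f.
  apply: (@L2I_bounded _ _ `|m|) => [|s _].
    by apply: measurable_funM => //; exact: measurable_indic (measurable_itv _).
  by rewrite /f normrM indicE ler_piMr// ger0_norm//; case: (_ \in _).
have E1 : ipI g f = m ^+ 2.
  rewrite /ipI expr2 {2}/m /prim -RintegralZl//; last exact: integrable_prim (ltW tT).
  rewrite -(setIidr (sub_itv0 (ltW tT))) Rintegral_mkcondr.
  apply: eq_Rintegral => s _; rewrite patchE /f indicE.
  by case: (_ \in _) => /=; rewrite ?mulr1 ?mulr0// mulrC.
have E2 : ipI f f <= m ^+ 2 * T.
  have LC := L2I_cst T m.
  apply: (@le_trans _ _ (ipI (cst m) (cst m))).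
    apply: le_Rintegral => //; try exact: L2I_integrableM.
    move=> s _; rewrite /f /= indicE; case: (_ \in _); rewrite ?mulr1// mulr0 mul0r.
    by rewrite -expr2 sqr_ge0.
  rewrite /ipI /cst Rintegral_cst// -expr2 /= lebesgue_measure_itv/= lte_fin T0/=.
  by rewrite subr0.
have := ipI_le T0 Lg Lf; rewrite E1 ger0_norm ?sqr_ge0//.
have : T^-1 * ipI f f <= m ^+ 2 by rewrite ler_pdivrMl// mulrC.
by rewrite /m; lra.
Qed.

Lemma ipI_prim_le g : L2I T g -> ipI (prim g) (prim g) <= T ^+ 2 * ipI g g.
Proof.
move=> Lg.
have LC := L2I_cst T (T * ipI g g).
have L1 := L2I_cst T 1.
apply: (@le_trans _ _ (ipI (cst (T * ipI g g)) (cst 1))).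
  apply: le_Rintegral => //; try (apply: L2I_integrableM => //; exact: L2I_prim).
  by move=> s Is; rewrite /= mulr1 -expr2; exact: prim_sq_le.
rewrite /ipI /cst Rintegral_cst// /= lebesgue_measure_itv/= lte_fin T0/=.
by rewrite subr0 mulr1 expr2 mulrAC.
Qed.

(** Lebesgue's differentiation theorem: almost every point is one where the primitive of the
    difference, which is identically zero, has the difference as its derivative. *)
Lemma prim_inj f g : L2I T f -> L2I T g -> (forall t, I t -> prim f t = prim g t) ->
  ae_eq mu I f g.
Proof.
move=> Lf Lg fg.
pose G := (fun t => 1 * f t + (-1) * g t) \_ I.
have LG := L2I_lin 1 (-1) Lf Lg.
have Gi : mu.-integrable setT (EFin \o G) by exact: integrable_patch.
have GiD (D : set R) : measurable D -> mu.-integrable D (EFin \o G).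
  by move=> mD; apply: (@integrableS _ _ _ mu setT).
have lG : locally_integrable setT G.
  exact: (integrable_locally (measurable_itv _) (L2I_integrable LG)).
have := @FTC1 _ G (BRight 0) (fun y => GiD _ (measurable_itv _)) lG.
apply: filterS; first exact: (ae_filter_ringOfSetsType mu).
move=> t /= ht It; have := It; rewrite /= in_itv/= => /andP[t0 tT].
have [_] := ht t0.
set F := (fun x : R => _).
have F0 s : I s -> F s = 0.
  move=> Is; have := Is; rewrite /= in_itv/= => /andP[_ /ltW sT].
  rewrite /F -Rintegral_itv_bndo_bndc; last exact: GiD.
  rewrite (_ : Rintegral _ _ _ = prim (fun t => 1 * f t + (-1) * g t) s).
    by rewrite prim_lin// fg// mul1r mulN1r subrr.
  by apply: eq_Rintegral => x /set_mem /(sub_itv0 sT) Ix; rewrite /G patchE mem_set.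
rewrite derive1E (@near_eq_derive _ _ _ F (cst 0)).
  rewrite derive_cst /G patchE mem_set// => /esym/eqP.
  by rewrite mul1r mulN1r subr_eq0 => /eqP.
near=> s; apply: F0; near: s.
exact: near_in_itvoo.
Unshelve. all: by end_near. Qed.

End Prim.

(** * Weak derivatives *)

Section WeakDerivative.
Context {R : realType}.
Variable T : R.
Hypothesis T0 : 0 < T.
Local Notation mu := (@lebesgue_measure R).
Local Notation I := (`]0, T[%classic : set R).
Local Notation ipI := (ipI T).
Implicit Types (f g h phi : R -> R) (a b c : R).

Lemma test_functionT phi t : test_function T phi -> ~ I t -> phi t = 0.
Proof.
move=> [_ _ sub] nIt; apply: contrapT => /eqP p0; apply: nIt; apply: sub.
exact: subset_closure.
Qed.

Lemma test_function_L2 phi : test_function T phi -> L2I T phi /\ L2I T (derive1 phi).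
Proof.
move=> [d c _]; split; apply: L2I_continuous; apply: continuous_subspaceT; last exact: c.
by move=> t; apply: differentiable_continuous; apply/derivable1_diffP; exact: d.
Qed.

Lemma Rintegral_derive1 phi s :
  (forall t, derivable phi t 1) -> continuous (derive1 phi) -> s < T ->
  \int[mu]_(t in `[s, T]) (derive1 phi t) = phi T - phi s.
Proof.
move=> d c sT; rewrite /Rintegral (@continuous_FTC2 _ _ phi _ _ sT).
- by [].
- by apply: continuous_subspaceT; exact: c.
- have cphi : continuous phi.
    by move=> t; apply: differentiable_continuous; apply/derivable1_diffP; exact: d.
  split.
  + by move=> t _; exact: d.
  + by apply: cvg_at_right_filter; exact: cphi.
  + by apply: cvg_at_left_filter; exact: cphi.
- by [].
Qed.

(** Fubini's theorem on the triangle x < y: integrating the derivative of the test function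
    over (x, T) leaves minus its value at [x], as it vanishes at [T]. *)
Lemma weak_derivative_prim g : L2I T g -> weak_derivative T (prim g) g.
Proof.
move=> Lg phi tphi; have [Lphi Ldphi] := test_function_L2 tphi.
(* The extensions by zero are opaque: the exchange of integrals uses only that they are
   integrable. *)
have [G GE] : exists G, G = g \_ I by exists (g \_ I).
have [P PE] : exists P, P = (derive1 phi) \_ I by exists ((derive1 phi) \_ I).
have Gi : mu.-integrable setT (EFin \o G)  by rewrite GE; exact: integrable_patch.
have Pi : mu.-integrable setT (EFin \o P)  by rewrite PE; exact: integrable_patch.
have mG : measurable_fun setT G by apply/measurable_EFinP; case/integrableP: Gi.
have mP : measurable_fun setT P by apply/measurable_EFinP; case/integrableP: Pi.
pose F (z : measurableTypeR R * measurableTypeR R) : R :=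
  if z.1 < z.2 then G z.1 * P z.2 else 0.
have mF : measurable_fun setT (EFin \o F).
  apply/measurable_EFinP; apply: measurable_fun_ifT.
  - apply: measurable_fun_ltr; [exact: measurable_fst|exact: measurable_snd].
  - apply: measurable_funM.
    + exact: (measurableT_comp mG measurable_fst).
    + exact: (measurableT_comp mP measurable_snd).
  - exact: measurable_cst.
have iF : (mu \x mu)%E.-integrable setT (EFin \o F).
  pose H (z : measurableTypeR R * measurableTypeR R) : R := G z.1 * P z.2.
  have mH : measurable_fun setT (EFin \o H).
    apply/measurable_EFinP; apply: measurable_funM.
    + exact: (measurableT_comp mG measurable_fst).
    + exact: (measurableT_comp mP measurable_snd).
  apply: (@le_integrable _ _ _ _ _ measurableT _ (EFin \o H)) => //.
    move=> z _ /=; rewrite /F /H; case: ifP => // _.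
    by rewrite normr0 lee_fin.
  apply/(integrable12ltyP _ _ mH).
  have cfin : ((\int[mu]_y `|(P y)%:E|)%E \is a fin_num).
    by rewrite ge0_fin_numE ?integral_ge0//; case/integrableP: Pi.
  have Ein x : (\int[mu]_y `|(EFin \o H) (x, y)| =
     (fine (\int[mu]_y `|(P y)%:E|))%:E * `|(G x)%:E|)%E.
    rewrite fineK// muleC -ge0_integralZl//; last first.
      by apply: measurableT_comp => //; exact/measurable_EFinP.
    by apply: eq_integral => y _ /=; rewrite /H normrM EFinM.
  under eq_integral do rewrite Ein.
  rewrite ge0_integralZl//.
  - by rewrite lte_mul_pinfty// ?lee_fin ?fine_ge0 ?integral_ge0//; case/integrableP: Gi.
  - by apply: measurableT_comp => //; exact/measurable_EFinP.
  - by rewrite lee_fin fine_ge0// integral_ge0.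
have := Fubini iF; rewrite /= => E.
have E1 (y : R) : (\int[mu]_x (F (x, y))%:E = (P y * prim g y)%:E)%E.
  rewrite /F/=; have [Iy|nIy] := pselect (I y); last first.
    have -> : P y = 0 by rewrite PE patchE memNset.
    rewrite mul0r.
    by apply: integral0_eq => x _; rewrite mulr0; case: ifP.
  have := Iy; rewrite /= in_itv/= => /andP[y0 yT].
  have iD := integrable_prim Lg (ltW yT).
  have pw1 (x : R) : (if x < y then G x * P y else 0)%:E =
      (if x \in `]0, y[%classic then (P y * g x)%:E else 0%E).
    rewrite mem_setE in_itv/= andbC; have [xy|//] := boolP (x < y).
    rewrite GE patchE mem_setE in_itv/= (lt_trans xy yT) andbT.
    by have [x0|x0] := boolP (0 < x); rewrite ?mul0r// mulrC.
  have -> : (\int[mu]_x (if x < y then G x * P y else 0)%:E =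
             \int[mu]_(x in `]0%R, y[) (P y * g x)%:E)%E.
    rewrite [RHS]integral_mkcond; apply: eq_integral => x _; rewrite patchE.
    exact: pw1.
  rewrite -[LHS]fineK; last first.
    apply: integrable_fin_num => //.
    rewrite (_ : (fun _ => _) = (fun t => (P y)%:E * (g t)%:E)%E)//.
    exact: integrableZl.
  by rewrite -/(Rintegral _ _ _) RintegralZl.
have E2 (x : R) : (\int[mu]_y (F (x, y))%:E = (- (G x * phi x))%:E)%E.
  rewrite /F/=; have [Ix|nIx] := pselect (I x); last first.
    have -> : G x = 0 by rewrite GE patchE memNset.
    rewrite mul0r oppr0.
    by apply: integral0_eq => y _; rewrite mul0r; case: ifP.
  have := Ix; rewrite /= in_itv/= => /andP[x0 xT].
  have sub : `]x, T[%classic `<=` I.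
    by move=> y; rewrite /= !in_itv/= => /andP[/(lt_trans x0) -> ->].
  have iD : mu.-integrable `]x, T[ (EFin \o derive1 phi).
    by apply: (@integrableS _ _ _ mu I) => //; exact: L2I_integrable.
  have pw2 (y : R) : (if x < y then G x * P y else 0)%:E =
      (if y \in `]x, T[%classic then (G x * derive1 phi y)%:E else 0%E).
    rewrite mem_setE in_itv/=; have [xy|//] := boolP (x < y).
    rewrite PE patchE mem_setE in_itv/= (lt_trans x0 xy)/=.
    by have [yT|yT] := boolP (y < T); rewrite ?mulr0.
  have -> : (\int[mu]_y (if x < y then G x * P y else 0)%:E =
             \int[mu]_(y in `]x, T[) (G x * derive1 phi y)%:E)%E.
    rewrite [RHS]integral_mkcond; apply: eq_integral => y _; rewrite patchE.
    exact: pw2.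
  rewrite -[LHS]fineK; last first.
    apply: integrable_fin_num => //.
    rewrite (_ : (fun _ => _) = (fun t => (G x)%:E * (derive1 phi t)%:E)%E)//.
    exact: integrableZl.
  rewrite -/(Rintegral _ _ _) RintegralZl//; congr EFin.
  rewrite Rintegral_itv_obnd_cbnd// Rintegral_itv_bndo_bndc; last first.
    apply: (@integrableS _ _ _ mu I) => //; last exact: L2I_integrable.
    by move=> y; rewrite /= !in_itv/= => /andP[/(lt_le_trans x0) -> ->].
  case: (tphi) => d c _; rewrite Rintegral_derive1// (test_functionT tphi).
    by rewrite sub0r mulrN.
  by rewrite /= in_itv/= ltxx andbF.
have -> : \int[mu]_(t in I) (prim g t * derive1 phi t) =
    fine (\int[mu]_y \int[mu]_x (F (x, y))%:E)%E.
  rewrite Rintegral_mkcond; congr fine; apply: eq_integral => y _; rewrite E1.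
  by rewrite PE !patchE; case: ifP => _; rewrite ?mul0r// mulrC.
rewrite -E.
have -> : (\int[mu]_x \int[mu]_y (F (x, y))%:E =
    (\int[mu]_(x in I) (- (g x * phi x))%:E))%E.
  rewrite [RHS]integral_mkcond; apply: eq_integral => x _; rewrite E2 GE !patchE.
  by case: ifP => //; rewrite mul0r oppr0.
have -> : fine (\int[mu]_(x in I) (- (g x * phi x))%:E)%E =
    \int[mu]_(x in I) ((-1) * (g x * phi x)).
  by apply: eq_Rintegral => x _; rewrite mulN1r.
by rewrite RintegralZl ?mulN1r//; exact: L2I_integrableM.
Qed.

End WeakDerivative.

(** * Functions with vanishing weak derivative *)

Section Tents.
Context {R : realType}.
Implicit Types (f g phi : R -> R) (a b c d e t x : R).

(** A second-order Taylor bound valid for all increments gives differentiability without any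
    case distinction at the kinks of piecewise polynomials. *)
Lemma is_derive_quad f d C x : (forall h : R, `|f (h + x) - f x - d * h| <= C * h ^+ 2) ->
  is_derive x (1 : R) f d.
Proof.
move=> H.
have cv : (fun h : R => h^-1 *: ((f \o shift x) (h *: (1 : R)) - f x)) @ 0^' --> d.
  apply/cvgrPdist_le => e e0.
  have C0 : 0 < `|C| + 1 by rewrite ltr_wpDl.
  near=> h.
  have h0 : h != 0 by near: h; exact: nbhs_dnbhs_neq.
  have he : `|h| <= e / (`|C| + 1).
    near: h; apply: dnbhs0_le; exact: divr_gt0.
  rewrite /= /shift/= [X in f (X + x)]mulr1.
  have -> : d - h^-1 *: (f (h + x) - f x) = - (h^-1 * (f (h + x) - f x - d * h)).
    by rewrite /GRing.scale/=; field.
  rewrite normrN normrM normfV ler_pdivrMl ?normr_gt0//.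
  apply: (le_trans (H h)); rewrite -sqr_normE expr2 mulrCA ler_wpM2l//.
  move: he; rewrite ler_pdivlMr// mulrDr mulr1 => he; apply: le_trans he.
  by rewrite mulrC -[leLHS]addr0 lerD// ler_wpM2l// ler_norm.
apply: DeriveDef; first by apply/cvg_ex; exists d.
by apply/cvg_lim => //; exact: Rhausdorff.
Unshelve. all: by end_near. Qed.

Definition pospart x : R := Num.max 0 x.
(** Second difference of the square of the positive part: a C^1 step of width [2 * e]. *)
Definition bump a e t :=
  pospart (t - a) ^+ 2 - 2 * pospart (t - a - e) ^+ 2 + pospart (t - a - 2 * e) ^+ 2.

(** The derivative of the step [bump a e]: a hat function on [a, a + 2 * e]. *)
Definition tent a e t :=
  2 * (pospart (t - a) - 2 * pospart (t - a - e) + pospart (t - a - 2 * e)).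

Lemma pospart_quad x h : `|pospart (h + x) ^+ 2 - pospart x ^+ 2 - 2 * pospart x * h| <= h ^+ 2.
Proof.
rewrite /pospart ler_norml; case: (leP 0 x) => x0; case: (leP 0 (h + x)) => y0;
  apply/andP; split; nra.
Qed.

Lemma bump_quad a e t h : `|bump a e (h + t) - bump a e t - tent a e t * h| <= 4 * h ^+ 2.
Proof.
have := pospart_quad (t - a) h; have := pospart_quad (t - a - e) h.
have := pospart_quad (t - a - 2 * e) h.
rewrite /bump /tent !addrA.
move: (pospart (h + t - a)) (pospart (t - a)) (pospart (h + t - a - e)) (pospart (t - a - e))
  (pospart (h + t - a - 2 * e)) (pospart (t - a - 2 * e)) => p1 p2 p3 p4 p5 p6.
rewrite !ler_norml => /andP[h1 h2] /andP[h3 h4] /andP[h5 h6]; apply/andP; split; lra.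
Qed.

Lemma bump_eq0 a e t : 0 <= e -> t <= a -> bump a e t = 0.
Proof.
by move=> e0 ta; rewrite /bump /pospart !max_l; try lra; rewrite expr0n/= mulr0 subrr addr0.
Qed.

Lemma bump_cst a e t : 0 <= e -> a + 2 * e <= t -> bump a e t = 2 * e ^+ 2.
Proof. by move=> e0 ta; rewrite /bump /pospart !max_r; try lra; ring. Qed.

Lemma tent_ge0 a e t : 0 <= e -> 0 <= tent a e t.
Proof.
move=> e0; rewrite /tent /pospart.
by case: (leP 0 (t - a)) => ?; case: (leP 0 (t - a - e)) => ?;
  case: (leP 0 (t - a - 2 * e)) => ?; lra.
Qed.

Lemma tent_eq0 a e t : 0 <= e -> ~~ (a < t < a + 2 * e) -> tent a e t = 0.
Proof.
move=> e0; rewrite negb_and -!leNgt /tent /pospart => /orP[ta|ta].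
  by rewrite !max_l; try lra.
by rewrite !max_r; try lra.
Qed.

Lemma tent_continuous a e : continuous (tent a e).
Proof.
have cp c : continuous (fun t => pospart (t - c)).
  move=> t; apply: (@continuous_max R R (cst 0) (fun t => t - c) t).
    exact: cst_continuous.
  by apply: cvgB; [exact: cvg_id|exact: cvg_cst].
move=> t; rewrite /tent; apply: cvgM; first exact: cvg_cst.
have E1 : (fun t => pospart (t - a - e)) = (fun t => pospart (t - (a + e))).
  by apply/funext => s; congr pospart; ring.
have E2 : (fun t => pospart (t - a - 2 * e)) = (fun t => pospart (t - (a + 2 * e))).
  by apply/funext => s; congr pospart; ring.
apply: cvgD; first apply: cvgB; first exact: cp.
  by apply: cvgM; [exact: cvg_cst|]; move: (cp (a + e) t); rewrite -E1; apply.
by move: (cp (a + 2 * e) t); rewrite -E2; apply.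
Qed.

Lemma bump_diff_derive a b e t :
  is_derive t (1 : R) (fun t => bump a e t - bump b e t) (tent a e t - tent b e t).
Proof.
apply: (@is_derive_quad _ _ 8) => h.
have := bump_quad a e t h; have := bump_quad b e t h.
move: (bump _ _ _) (bump _ _ _) (bump _ _ _) (bump _ _ _) (tent a e t) (tent b e t).
move=> p1 p2 p3 p4 p5 p6.
by rewrite !ler_norml => /andP[h1 h2] /andP[h3 h4]; apply/andP; split; lra.
Qed.

Variable T : R.
Hypothesis T0 : 0 < T.
Local Notation mu := (@lebesgue_measure R).
Local Notation I := (`]0, T[%classic : set R).
Local Notation ipI := (ipI T).

Lemma tent_L2I a e : L2I T (tent a e).
Proof.
by apply: L2I_continuous => //; apply: continuous_subspaceT; exact: tent_continuous.
Qed.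

Lemma bump_diff_test a b e : 0 < e -> 0 < a -> a + 2 * e <= b -> b + 2 * e < T ->
  test_function T (fun t => bump a e t - bump b e t) /\
  derive1 (fun t => bump a e t - bump b e t) = (fun t => tent a e t - tent b e t).
Proof.
move=> e0 a0 ab bT.
have D : derive1 (fun t => bump a e t - bump b e t) = (fun t => tent a e t - tent b e t).
  by apply/funext => t; rewrite derive1E; apply: derive_val; exact: bump_diff_derive.
split => //; split.
- by move=> t; apply: ex_derive; exact: bump_diff_derive.
- by rewrite D => t; apply: cvgB; exact: tent_continuous.
apply: (@subset_trans _ `[a, b + 2 * e]).
  have cl : closed (`[a, b + 2 * e]%classic : set R) by exact: interval_closed.
  have /closure_id -> := cl; apply: closure_subset => t /=.
  rewrite in_itv/= => /negP h; apply: contrapT => /negP.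
  rewrite negb_and -!ltNge => /orP[|] ht; apply: h.
    by rewrite !bump_eq0 ?subr0//; lra.
  by rewrite !bump_cst ?subrr//; lra.
move=> t; rewrite /= !in_itv/= => /andP[at_ tb]; apply/andP; split; lra.
Qed.

Lemma ipI_tent a e : 0 <= a -> 0 < e -> a + 2 * e <= T ->
  ipI (cst 1) (tent a e) = 2 * e ^+ 2.
Proof.
move=> a0 e0 aT.
have d t : is_derive t (1 : R) (bump a e) (tent a e t).
  by apply: (@is_derive_quad _ _ 4) => h; exact: bump_quad.
have D : derive1 (bump a e) = tent a e.
  by apply/funext => t; rewrite derive1E; apply: derive_val.
have := @Rintegral_derive1 R T (bump a e) 0 (fun t => @ex_derive _ _ _ _ _ _ _ (d t)).
rewrite D => /(_ (@tent_continuous a e) T0).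
rewrite bump_cst ?(ltW e0)// bump_eq0 ?(ltW e0)// subr0 => <-.
have ti (J : set R) : measurable J -> J `<=` `[0, T] -> mu.-integrable J (EFin \o tent a e).
  move=> mJ sub; apply: (@integrableS _ _ _ mu `[0, T]%classic) => //.
  apply: continuous_compact_integrable; first exact: segment_compact.
  by apply: continuous_subspaceT; exact: tent_continuous.
rewrite -Rintegral_itv_obnd_cbnd; last by apply: ti => //; exact: subset_itv_oc_cc.
rewrite -Rintegral_itv_bndo_bndc; last by apply: ti => //; exact: subset_itv_oo_cc.
by apply: eq_Rintegral => t _; rewrite /cst mul1r.
Qed.

Lemma within_cont_dist (h : R -> R) x e :
  {within `[0, T], continuous h} -> 0 <= x <= T -> 0 < e ->
  exists2 d, 0 < d & forall s, 0 <= s <= T -> `|s - x| < d -> `|h s - h x| < e.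
Proof.
move=> ch xT e0.
have /cvgrPdist_lt /(_ e e0) near_x := ch x.
have : within `[0, T] (nbhs x) (fun s => `|h x - h s| < e).
  by rewrite nbhs_subspace_in//= in_itv.
move=> /nbhs_ballP[d /= d0 H].
exists d => // s sT sd; rewrite distrC; apply: H; last by rewrite in_itv.
by rewrite /ball/= distrC.
Qed.

(** If [h b] were positive, test with a step up near 0 and a step down right after [b].  The
    derivative of this test function is the difference of two hats of equal mass; near 0 the
    function [h] is at most [h b / 3], by continuity and [h 0 = 0], and near [b] at least
    twice as much, so that the integral would be negative. *)
Lemma weakly_constant_le0 (h : R -> R) : {within `[0, T], continuous h} -> h 0 = 0 ->
  (forall phi, test_function T phi -> ipI h (derive1 phi) = 0) -> forall b, I b -> h b <= 0.
Proof.
move=> ch h0 H b; rewrite /= in_itv/= => /andP[b0 bT].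
rewrite leNgt; apply/negP => hb.
pose n := h b / 3; have n0 : 0 < n by rewrite divr_gt0.
have Lh := L2I_continuous ch.
have T00 : 0 <= (0 : R) <= T by rewrite lexx ltW.
have bTT : 0 <= b <= T by rewrite !ltW.
have [d1 d10 h1] := within_cont_dist ch T00 n0.
have [d2 d20 h2] := within_cont_dist ch bTT n0.
(* Both hats, of width [2 * e], must fit where the bounds hold: [e, 3 * e] before [b]
   and within [d1] of 0, and [b, b + 2 * e] before [T] and within [d2] of [b]. *)
have [e e0 [e1 e2 e3 e4]] : exists2 e, 0 < e &
    [/\ 4 * e <= d1, 4 * e <= d2, 4 * e <= T - b & 4 * e <= b].
  exists (Num.min (Num.min d1 d2) (Num.min (T - b) b) / 4).
    by rewrite divr_gt0// !lt_min d10 d20 b0 subr_gt0 bT.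
  set m := Num.min _ _; have -> : 4 * (m / 4) = m by field.
  by rewrite /m !ge_min !lexx !orbT.
have [] := @bump_diff_test e b e e0 e0; [lra|lra|].
move=> tphi D; have := H _ tphi; rewrite D.
have L1 := tent_L2I e e; have L2 := tent_L2I b e.
have -> : (fun t => tent e e t - tent b e t) = (fun t => 1 * tent e e t + (-1) * tent b e t).
  by apply/funext => t; rewrite mul1r mulN1r.
rewrite ipI_linr//.
have C1 := L2I_cst T 1; have C0 := L2I_cst T 0.
have ipI_cst c a : ipI (cst c) (tent a e) = c * ipI (cst 1) (tent a e).
  rewrite (_ : cst c = (fun t => c * (cst 1 : R -> R) t + 0 * (cst 0 : R -> R) t)).
    by rewrite ipI_linl ?mul0r ?addr0//; exact: tent_L2I.
  by apply/funext => t; rewrite /cst mulr1 mulr0 addr0.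
have B1 : ipI h (tent e e) <= n * (2 * e ^+ 2).
  rewrite -(@ipI_tent e e) ?(ltW e0)//; last lra.
  rewrite -ipI_cst; apply: le_Rintegral => //; try (apply: L2I_integrableM => //; exact: L2I_cst).
  move=> t; rewrite /= in_itv/= => /andP[t0 tT].
  have [/andP[te te2]|/tent_eq0 ->] := boolP (e < t < e + 2 * e); rewrite ?mulr0 ?(ltW e0)//.
  apply: ler_wpM2r; first exact/tent_ge0/ltW.
  have := h1 t; rewrite h0 !subr0 => h1t; apply: ltW; apply: le_lt_trans (h1t _ _).
  - exact: ler_norm.
  - by rewrite !ltW.
  - by rewrite gtr0_norm//; lra.
have B2 : 2 * n * (2 * e ^+ 2) <= ipI h (tent b e).
  rewrite -(@ipI_tent b e) ?(ltW b0)//; last lra.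
  rewrite -ipI_cst; apply: le_Rintegral => //; try (apply: L2I_integrableM => //; exact: L2I_cst).
  move=> t; rewrite /= in_itv/= => /andP[t0 tT].
  have [/andP[te te2]|/tent_eq0 ->] := boolP (b < t < b + 2 * e); rewrite ?mulr0 ?(ltW e0)//.
  apply: ler_wpM2r; first exact/tent_ge0/ltW.
  have /h2 : 0 <= t <= T by rewrite !ltW.
  have tb : `|t - b| < d2 by rewrite gtr0_norm ?subr_gt0//; lra.
  by move=> /(_ tb); rewrite ltr_norml /n => /andP[]; lra.
have e20 : 0 < n * e ^+ 2 by rewrite mulr_gt0// exprn_gt0.
move: B1 B2 e20; move: (ipI h _) (ipI h _) (n) (e ^+ 2) => x y k m; nra.
Qed.

Lemma weakly_constant_eq0 (h : R -> R) : {within `[0, T], continuous h} -> h 0 = 0 ->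
  (forall phi, test_function T phi -> ipI h (derive1 phi) = 0) -> forall b, I b -> h b = 0.
Proof.
move=> ch h0 H b Ib; apply/eqP; rewrite eq_le (weakly_constant_le0 ch h0 H Ib)/=.
rewrite -oppr_le0; apply: (@weakly_constant_le0 (fun t => - h t)) => //.
- by move=> t; apply: continuousN; exact: ch.
- by rewrite h0 oppr0.
move=> phi tphi; have [_ Lp] := test_function_L2 tphi.
have Lh := L2I_continuous ch; have C0 := L2I_cst T 0.
rewrite (_ : (fun t => - h t) = (fun t => (-1) * h t + 0 * (cst 0 : R -> R) t)).
  by rewrite ipI_linl// H// mulr0 mul0r addr0.
by apply/funext => t; rewrite mulN1r mul0r addr0.
Qed.

(** The fundamental theorem of calculus for H^1: the continuous representative minus the
    primitive of [g] is weakly constant and vanishes at 0. *)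
Lemma weak_derivative_representative f g u : L2I T f -> L2I T g -> weak_derivative T f g ->
  ae_eq mu I f u -> {within `[0, T], continuous u} -> u 0 = 0 ->
  forall t, I t -> u t = prim g t.
Proof.
move=> Lf Lg wfg fu cu u0 t It; apply/eqP; rewrite -subr_eq0; apply/eqP.
have Lu := L2I_continuous cu; have Lp := L2I_prim T0 Lg.
apply: (@weakly_constant_eq0 (fun t => u t - prim g t)) => //.
- by move=> s; apply: continuousB; [exact: cu|exact: prim_continuous].
- by rewrite u0 prim0// subr0.
move=> phi tphi; have [Lphi Ldphi] := test_function_L2 tphi.
rewrite (_ : (fun t => _) = (fun t => 1 * u t + (-1) * prim g t)); last first.
  by apply/funext => s; rewrite mul1r mulN1r.
rewrite ipI_linl// -(ipI_aeE Lf Lu Ldphi fu).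
have := weak_derivative_prim Lg tphi; have := wfg phi tphi.
rewrite -!/(ipI _ _) => -> ->.
by rewrite mul1r mulN1r subrr.
Qed.

End Tents.

(** * The space H^1_0, in one component *)

Section H10.
Context {R : realType}.
Variable T : R.
Hypothesis T0 : 0 < T.
Local Notation mu := (@lebesgue_measure R).
Local Notation I := (`]0, T[%classic : set R).
Local Notation ipI := (ipI T).
Implicit Types (f g phi : R -> R) (a b c d e t x : R).

Lemma H10I_wderiv f : H10I T f -> L2I T (wderiv T f) /\ weak_derivative T f (wderiv T f).
Proof. by case=> _ ex _; exact: (xgetPex 0 ex). Qed.

Lemma H10I_prim f : H10I T f -> ae_eq mu I f (prim (wderiv T f)).
Proof.
move=> Hf; have [Lg wg] := H10I_wderiv Hf; case: Hf => Lf _ [u [fu cu u0]].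
apply: (filterS _ fu) => t ft It; rewrite ft//.
exact: (weak_derivative_representative T0 Lf Lg wg fu cu u0).
Qed.

(** Together with [H10I_prim] this identifies the functions of H^1 vanishing at 0 with the
    primitives of square integrable functions; every property of weak derivatives below is
    read off from the corresponding property of primitives. *)
Lemma prim_H10I f g : L2I T f -> L2I T g -> ae_eq mu I f (prim g) ->
  H10I T f /\ ae_eq mu I (wderiv T f) g.
Proof.
move=> Lf Lg fg; have Lp := L2I_prim T0 Lg.
have w : weak_derivative T f g.
  move=> phi tphi; have [_ Ld] := test_function_L2 tphi.
  rewrite -(weak_derivative_prim Lg tphi); exact: (ipI_aeE Lf Lp Ld fg).
have Hf : H10I T f.
  split => //; first by exists g.
  by exists (prim g); split => //; [exact: prim_continuous|exact: prim0].
split => //; have [Lw ww] := H10I_wderiv Hf.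
apply: (prim_inj Lw Lg) => t It.
have p0 : prim g 0 = 0 by exact: prim0.
by rewrite -(weak_derivative_representative T0 Lf Lw ww fg (prim_continuous T0 Lg) p0 It).
Qed.

Lemma H10I_lin a b f g : H10I T f -> H10I T g ->
  H10I T (fun t => a * f t + b * g t) /\
  ae_eq mu I (wderiv T (fun t => a * f t + b * g t))
    (fun t => a * wderiv T f t + b * wderiv T g t).
Proof.
move=> Hf Hg; have [Lf' _] := H10I_wderiv Hf; have [Lg' _] := H10I_wderiv Hg.
have Ef := H10I_prim Hf; have Eg := H10I_prim Hg.
case: Hf => Lf _ _; case: Hg => Lg _ _.
apply: prim_H10I; [exact: L2I_lin|exact: L2I_lin|].
apply: filterS2 Ef Eg => t Ef Eg It; rewrite Ef// Eg// (prim_lin a b Lf' Lg')//.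
by move: It; rewrite /= in_itv/= => /andP[_ /ltW].
Qed.

Lemma H10I_delay L f : 0 < L -> H10I T f ->
  H10I T (delay L f) /\ ae_eq mu I (wderiv T (delay L f)) (delay L (wderiv T f)).
Proof.
move=> L0 Hf; have [Lf' _] := H10I_wderiv Hf; have Ef := H10I_prim Hf; case: Hf => Lf _ _.
apply: prim_H10I; [exact: L2I_delay|exact: L2I_delay|].
apply: filterS (ae_eq_delay L0 Ef) => t E It; rewrite E//.
by rewrite (prim_delay L0 Lf').
Qed.

Lemma ipI_aeEE f g : L2I T f -> L2I T g -> ae_eq mu I f g -> ipI f f = ipI g g.
Proof.
by move=> Lf Lg fg; rewrite (ipI_aeE Lf Lg Lf fg) ipC (ipI_aeE Lf Lg Lg fg).
Qed.

Lemma ipI_H10I_le f : H10I T f -> ipI f f <= T ^+ 2 * ipI (wderiv T f) (wderiv T f).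
Proof.
move=> Hf; have [Lf' _] := H10I_wderiv Hf; have Ef := H10I_prim Hf; case: Hf => Lf _ _.
by rewrite (ipI_aeEE Lf (L2I_prim T0 Lf') Ef) ipI_prim_le.
Qed.

Lemma ipI_lin_le a b f g : L2I T f -> L2I T g ->
  ipI (fun t => a * f t + b * g t) (fun t => a * f t + b * g t) <=
  2 * (a ^+ 2 * ipI f f + b ^+ 2 * ipI g g).
Proof.
move=> Lf Lg; have := ipI_ge0 T (fun t => a * f t + (- b) * g t).
have L1 := L2I_lin a b Lf Lg; have L2 := L2I_lin a (-b) Lf Lg.
rewrite !ipI_linl// !ipI_linr//.
rewrite (ipC T g f); move: (ipI f f) (ipI g g) (ipI f g) => x y z; nra.
Qed.

Lemma prim_ramp a b t : 0 <= a -> t <= T ->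
  prim (fun s => b * (if a < s then 1 else 0)) t = b * pospart (t - a).
Proof.
move=> a0 tT; rewrite /prim.
have [ta|ta] := leP t a.
  rewrite /pospart max_l ?mulr0; last lra.
  rewrite (@eq_Rintegral _ _ _ _ _ (fun=> 0)) ?Rintegral_cst ?mul0r//.
  move=> s /set_mem; rewrite /= in_itv/= => /andP[_ st].
  by rewrite ltNge (le_trans (ltW st) ta)/= mulr0.
rewrite /pospart max_r; last lra.
have -> : \int[mu]_(s in `]0, t[) (b * (if a < s then 1 else 0)) = \int[mu]_(s in `]a, t[) b.
  rewrite Rintegral_mkcond [RHS]Rintegral_mkcond; apply: eq_Rintegral => s _.
  rewrite !patchE !mem_setE !in_itv/=; have [as_|] := boolP (a < s) => /=.
    by rewrite (le_lt_trans a0 as_) mulr1.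
  by rewrite mulr0; case: ifP.
by rewrite Rintegral_cst//= lebesgue_measure_itv/= lte_fin ta.
Qed.

Lemma within_cont_cst (h : R -> R) a x k : {within `[0, T], continuous h} ->
  0 <= a -> a < x -> x <= T -> (forall t, a < t < x -> h t = k) -> h a = k /\ h x = k.
Proof.
move=> ch a0 ax xT hk.
have aT : 0 <= a <= T by rewrite a0 (le_trans (ltW ax)).
have xTT : 0 <= x <= T by rewrite xT andbT (le_trans a0 (ltW ax)).
split; apply/eqP; rewrite -subr_eq0 -normr_eq0; apply/negPn/negP => ne.
- have e0 : 0 < `|h a - k| by rewrite lt_neqAle eq_sym ne /=.
  have [d d0 H] := within_cont_dist ch aT e0.
  pose m := Num.min d (x - a).
  have m0 : 0 < m by rewrite lt_min d0 subr_gt0.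
  have m1 : m <= d by rewrite ge_min lexx.
  have m2 : m <= x - a by rewrite ge_min lexx orbT.
  have tT : 0 <= a + m / 2 <= T by apply/andP; split; lra.
  have dd : `|a + m / 2 - a| < d by rewrite addrAC subrr add0r gtr0_norm; lra.
  have := H _ tT dd; rewrite (hk (a + m / 2)); last by apply/andP; split; lra.
  by rewrite (distrC k) ltxx.
- have e0 : 0 < `|h x - k| by rewrite lt_neqAle eq_sym ne /=.
  have [d d0 H] := within_cont_dist ch xTT e0.
  pose m := Num.min d (x - a).
  have m0 : 0 < m by rewrite lt_min d0 subr_gt0.
  have m1 : m <= d by rewrite ge_min lexx.
  have m2 : m <= x - a by rewrite ge_min lexx orbT.
  have tT : 0 <= x - m / 2 <= T by apply/andP; split; lra.
  have dd : `|x - m / 2 - x| < d by rewrite addrAC subrr add0r normrN gtr0_norm; lra.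
  have := H _ tT dd; rewrite (hk (x - m / 2)); last by apply/andP; split; lra.
  by rewrite (distrC k) ltxx.
Qed.

Definition affine_on f (e : R * R) :=
  exists a b, forall t, e.1 < t < e.2 -> f t = a + b * t.

Lemma mem_zip_fst (S1 S2 : eqType) (s1 : seq S1) (s2 : seq S2) (e : S1 * S2) :
  e \in zip s1 s2 -> e.1 \in s1.
Proof.
elim: s1 s2 => [|x1 s1 IH] [|x2 s2]//=; rewrite !inE => /predU1P[->/=|/IH ->].
  by rewrite eqxx.
by rewrite orbT.
Qed.

(** By induction on the elements that remain: subtracting a ramp starting at the node [a]
    makes [f] constant, hence zero by continuity, on the first of them.  Each ramp is the
    primitive of a step. *)
Lemma piecewise_affine_prim s a f : path <%R a s -> last a s = T -> 0 <= a ->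
  {within `[0, T], continuous f} -> (forall t, 0 <= t <= a -> f t = 0) ->
  (forall e : R * R, e \in zip (a :: s) s -> affine_on f e) ->
  exists2 g, L2I T g & forall t, 0 <= t <= T -> f t = prim g t.
Proof.
elim: s a f => [|x s IH] a f /=.
  move=> _ <- a0 _ f0 _; exists (cst 0); first exact: L2I_cst.
  move=> t /f0 ->; rewrite /prim Rintegral_cst ?mul0r//.
move=> /andP[ax ps] lx a0 cf f0 aff.
have [al [be hal]] := aff (a, x) (mem_head _ _).
have xT : x <= T.
  rewrite -lx; have := mem_last x s; rewrite inE => /predU1P[->//|lxs].
  by have /order_path_min -/(_ lt_trans)/allP/(_ _ lxs)/ltW := ps.
pose r t := be * pospart (t - a).
have cr : continuous r.
  move=> t; apply: cvgM; first exact: cvg_cst.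
  apply: (@continuous_max R R (cst 0) (fun t => t - a) t); first exact: cst_continuous.
  by apply: cvgB; [exact: cvg_id|exact: cvg_cst].
pose f' t := f t - r t.
have cf' : {within `[0, T], continuous f'}.
  move=> t; apply: continuousB; first exact: cf.
  by move: t; apply: continuous_subspaceT.
have r0 t : t <= a -> r t = 0 by move=> ta; rewrite /r /pospart max_l ?mulr0//; lra.
have rE t : a <= t -> r t = be * (t - a) by move=> ta; rewrite /r /pospart max_r//; lra.
have f'a t : 0 <= t <= a -> f' t = 0.
  by move=> /andP[t0 ta]; rewrite /f' f0 ?t0// r0// subr0.
have f'k t : a < t < x -> f' t = al + be * a.
  by move=> /[dup] /andP[at_ _] atx; rewrite /f' hal// rE ?ltW//; ring.
(* On the first element [f'] is constant; its value is that at [a], namely 0. *)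
have [k0 fx] := within_cont_cst cf' a0 ax xT f'k.
have {}k0 : al + be * a = 0 by rewrite -k0 f'a// a0 lexx.
have [] := IH x f' ps lx (le_trans a0 (ltW ax)) cf'.
- move=> t /andP[t0 tx]; have [ta|ta] := leP t a; first by rewrite f'a// t0.
  move: tx; rewrite le_eqVlt => /predU1P[->|tx]; first by rewrite fx.
  by rewrite f'k ?ta.
- move=> e es; have es' : e \in (a, x) :: zip (x :: s) s by rewrite inE es orbT.
  have [a' [b' h']] := aff e es'.
  have xe : x <= e.1.
    have := mem_zip_fst es.
    rewrite inE => /predU1P[->//|es1].
    by have /order_path_min -/(_ lt_trans)/allP/(_ _ es1)/ltW := ps.
  exists (a' + be * a), (b' - be) => t et; rewrite /f' h'// rE; first by ring.
  by case/andP: et => et _; rewrite ltW// (lt_trans ax)// (le_lt_trans xe).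
move=> g Lg fg.
have Lr : L2I T (fun s => be * (if a < s then 1 else 0)).
  apply: (@L2I_bounded _ _ `|be|) => [|s' _].
    apply: measurable_funM => //.
    rewrite (_ : (fun _ => _) = \1_(`]a, +oo[%classic : set R)).
      by apply: measurable_indic; exact: measurable_itv.
    apply/funext => s'; rewrite indicE mem_setE in_itv/= andbT.
    by case: ifP.
  by rewrite normrM ler_piMr//; case: ifP; rewrite ?normr1 ?normr0.
exists (fun s => 1 * g s + 1 * (be * (if a < s then 1 else 0))); first exact: L2I_lin.
move=> t /[dup] /andP[t0 tT] t0T; rewrite (prim_lin 1 1 Lg Lr tT) prim_ramp//.
by rewrite -fg// /f' !mul1r subrK.
Qed.

Lemma S1I_H10I s f : itv_partition 0 T s -> S1I T s f -> H10I T f.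
Proof.
move=> [ps /eqP ls] [cf f0 aff].
have [|g Lg fg] := piecewise_affine_prim ps ls (lexx 0) cf _ aff.
  by move=> t; rewrite -eq_le => /eqP <-.
have [] // := @prim_H10I f g (L2I_continuous cf) Lg.
apply: aeW => t; rewrite /= in_itv/= => /andP[t0 tT]; apply: fg.
by rewrite !ltW.
Qed.

Lemma S1I_lin s a b f g : S1I T s f -> S1I T s g -> S1I T s (fun t => a * f t + b * g t).
Proof.
move=> [cf f0 hf] [cg g0 hg]; split.
- move=> t; apply: cvgD; apply: cvgM; first [exact: cvg_cst | exact: cf | exact: cg].
- by rewrite f0 g0 !mulr0 addr0.
move=> e es; have [a1 [b1 h1]] := hf _ es; have [a2 [b2 h2]] := hg _ es.
exists (a * a1 + b * a2), (a * b1 + b * b2) => t et.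
by rewrite h1// h2//; ring.
Qed.

End H10.

(** * Pairs of functions and the H^1/2 norm *)

Lemma sup_nonneg (R : realType) (S : set R) : (forall r, S r -> 0 <= r) -> 0 <= sup S.
Proof.
move=> S0; have [[r Sr]|/set0P/negP/negPn/eqP->] := pselect (S !=set0); last by rewrite sup0.
have [ubS|nub] := pselect (has_ubound S); last by rewrite sup_out// => -[].
exact: le_trans (S0 _ Sr) (ub_le_sup ubS Sr).
Qed.

Section Pairs.
Context {R : realType}.
Variable T : R.
Hypothesis T0 : 0 < T.
Local Notation mu := (@lebesgue_measure R).
Local Notation I := (`]0, T[%classic : set R).
Local Notation ipI := (ipI T).
Implicit Types (u v w x y : sigma_fun R) (a b c d : R).

Definition lincomb a b u v : sigma_fun R :=
  (fun t => a * u.1 t + b * v.1 t, fun t => a * u.2 t + b * v.2 t).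

Local Notation Q v := (pairing T v v).

Lemma pairingE u v : pairing T u v = ipI u.1 v.1 + ipI u.2 v.2. Proof. by []. Qed.

Lemma addS_lincomb u v : u + v = lincomb 1 1 u v.
Proof. by congr pair; apply/funext => t; rewrite /= !mul1r. Qed.

Lemma subS_lincomb u v : u - v = lincomb 1 (-1) u v.
Proof. by congr pair; apply/funext => t; rewrite /= mul1r mulN1r. Qed.

Lemma oppS_lincomb u : - u = lincomb (-1) 0 u u.
Proof. by congr pair; apply/funext => t; rewrite /= mulN1r mul0r addr0. Qed.

Lemma L2S_lin a b u v : L2S T u -> L2S T v -> L2S T (lincomb a b u v).
Proof. by move=> [? ?] [? ?]; split; apply: L2I_lin. Qed.

Lemma H1S_lin a b u v : H1S T u -> H1S T v -> H1S T (lincomb a b u v) /\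
  ae_eqS T (dt T (lincomb a b u v)) (lincomb a b (dt T u) (dt T v)).
Proof.
move=> [h1 h2] [h3 h4]; have [] := H10I_lin T0 a b h1 h3; have [] := H10I_lin T0 a b h2 h4.
by move=> ? ? ? ?; split; split.
Qed.

Lemma H1S_L2S u : H1S T u -> L2S T u.
Proof. by move=> [[? _ _] [? _ _]]; split. Qed.

Lemma H1S_dt u : H1S T u -> L2S T (dt T u).
Proof.
by move=> [h1 h2]; split; [have [] := H10I_wderiv h1|have [] := H10I_wderiv h2].
Qed.

Lemma H1S_0 : H1S T 0 /\ ae_eqS T (dt T 0) 0.
Proof.
have C0 := L2I_cst T 0.
have [] := @prim_H10I _ T T0 (cst 0) (cst 0) C0 C0.
  by apply: aeW => t _; rewrite /prim Rintegral_cst// mul0r.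
by move=> h1 h2; split; split.
Qed.

Lemma L2S_0 : L2S T 0.
Proof. by split; exact: (L2I_cst T 0). Qed.

Lemma Q_ge0 v : 0 <= Q v.
Proof. by rewrite pairingE addr_ge0// ipI_ge0. Qed.

Lemma normL2S_sq v : normL2S T v ^+ 2 = Q v.
Proof. by rewrite sqr_sqrtr// Q_ge0. Qed.

Lemma normH1S_sq v : normH1S T v ^+ 2 = Q (dt T v).
Proof. exact: normL2S_sq. Qed.

Lemma Q_young d u v : 0 < d -> L2S T u -> L2S T v ->
  Q (lincomb 1 1 u v) <= (1 + d) * Q u + (1 + d^-1) * Q v.
Proof.
move=> d0 [u1 u2] [v1 v2]; rewrite -addS_lincomb !pairingE.
have := ipI_young d0 u1 v1; have := ipI_young d0 u2 v2.
rewrite !mulrDr => h1 h2; rewrite addrACA; exact: lerD.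
Qed.

Lemma Q_lin_le a b u v : L2S T u -> L2S T v ->
  Q (lincomb a b u v) <= 2 * (a ^+ 2 * Q u + b ^+ 2 * Q v).
Proof.
move=> [u1 u2] [v1 v2]; rewrite !pairingE.
have := ipI_lin_le a b u1 v1; have := ipI_lin_le a b u2 v2.
rewrite /lincomb/=; lra.
Qed.

Lemma Q_ae u v : L2S T u -> L2S T v -> ae_eqS T u v -> Q u = Q v.
Proof.
by move=> [u1 u2] [v1 v2] [e1 e2]; rewrite !pairingE (ipI_aeEE u1 v1 e1) (ipI_aeEE u2 v2 e2).
Qed.

Lemma Q_eq0_ae v : L2S T v -> Q v = 0 -> ae_eqS T v 0.
Proof.
move=> [v1 v2]; rewrite pairingE => /eqP.
rewrite paddr_eq0 ?ipI_ge0// => /andP[/eqP h1 /eqP h2].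
by split; apply: ip0_ae.
Qed.

Lemma pairing_linl a b u v w : L2S T u -> L2S T v -> L2S T w ->
  pairing T (lincomb a b u v) w = a * pairing T u w + b * pairing T v w.
Proof.
move=> [u1 u2] [v1 v2] [w1 w2]; rewrite !pairingE /lincomb /= !ipI_linl//; ring.
Qed.

Lemma pairing0l w : L2S T w -> pairing T 0 w = 0.
Proof.
move=> Lw; have -> : 0 = lincomb 0 0 w w :> sigma_fun R.
  by congr pair; apply/funext => t; rewrite /= !mul0r addr0.
by rewrite pairing_linl// !mul0r addr0.
Qed.

Lemma pairingC u v : pairing T u v = pairing T v u.
Proof. by rewrite !pairingE ipC (ipC T u.2). Qed.

Lemma pairing_ae u v w : L2S T u -> L2S T v -> L2S T w -> ae_eqS T u v ->
  pairing T u w = pairing T v w.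
Proof.
move=> [u1 u2] [v1 v2] [w1 w2] [e1 e2].
by rewrite !pairingE (ipI_aeE u1 v1 w1 e1) (ipI_aeE u2 v2 w2 e2).
Qed.

Lemma pairing_le s u v : 0 < s -> L2S T u -> L2S T v ->
  2 * `|pairing T u v| <= s * Q u + s^-1 * Q v.
Proof.
move=> s0 [u1 u2] [v1 v2]; rewrite !pairingE.
have := ipI_le s0 u1 v1; have := ipI_le s0 u2 v2.
have := ler_normD (ipI u.1 v.1) (ipI u.2 v.2); lra.
Qed.

Lemma Q_poincare x : H1S T x -> Q x <= T ^+ 2 * Q (dt T x).
Proof.
move=> [h1 h2]; rewrite !pairingE mulrDr.
by apply: lerD; apply: ipI_H10I_le.
Qed.

Lemma normH1S0 : normH1S T 0 = 0.
Proof.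
have [h e] := H1S_0; apply/eqP; rewrite sqrtr_eq0 (Q_ae (H1S_dt h) L2S_0 e).
by rewrite pairing0l//; exact: L2S_0.
Qed.

Lemma H12S_add u v : H12S T u -> H12S T v ->
  H12S T (u + v) /\ normH12S T (u + v) <= normH12S T u + normH12S T v.
Proof.
move=> [u1 u2] [v1 v2]; have [h0 _] := H1S_0.
have [] := interp_normD h0 u2 v2.
  move=> d d0; apply: interp_sqD => //.
  - by move=> x y hx hy; rewrite addS_lincomb; have [] := H1S_lin 1 1 hx hy.
  - move=> x y hx hy; rewrite !normL2S_sq opprD addrACA addS_lincomb.
    by apply: Q_young => //; rewrite subS_lincomb; apply: L2S_lin => //; exact: H1S_L2S.
  - move=> x y hx hy; rewrite addS_lincomb.
    move: normH1S_sq; move: (normH1S T) => n nE; rewrite !nE.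
    have [hxy e] := H1S_lin 1 1 hx hy.
    rewrite (Q_ae (H1S_dt hxy) _ e); last by apply: L2S_lin; exact: H1S_dt.
    by apply: Q_young => //; exact: H1S_dt.
move=> h1 h2; split => //; split => //.
by rewrite addS_lincomb; exact: L2S_lin.
Qed.

Lemma H12S_map (A : sigma_fun R -> sigma_fun R) v :
  (forall w, L2S T w -> L2S T (A w)) ->
  (forall x, H1S T x -> H1S T (A x) /\ Q (dt T (A x)) <= Q (dt T x)) ->
  (forall x, A v - A x = A (v - x)) ->
  (forall w, L2S T w -> Q (A w) <= Q w) ->
  H12S T v -> H12S T (A v) /\ normH12S T (A v) <= normH12S T v.
Proof.
move=> AL AH Alin AQ [v1 v2]; have [h0 _] := H1S_0.
have le : (interp_sq (H1S T) (normH1S T) (normL2S T) (A v) <=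
           interp_sq (H1S T) (normH1S T) (normL2S T) v)%E.
  rewrite -[leRHS]mul1e; apply: interp_sq_map => //.
  - by move=> x /AH[].
  - move=> x hx; rewrite !normL2S_sq mul1r Alin; apply: AQ.
    by rewrite subS_lincomb; apply: L2S_lin => //; exact: H1S_L2S.
  - by move=> x /AH[_]; move: normH1S_sq; move: (normH1S T) => n nE; rewrite !nE mul1r.
have lt := le_lt_trans le v2.
split; first by split => //; exact: AL.
exact: (interp_norm_le h0 v2 le).
Qed.

Lemma Q_opp w : L2S T w -> Q (lincomb (-1) 0 w w) = Q w.
Proof.
move=> Lw; have Ll := L2S_lin (-1) 0 Lw Lw.
rewrite (pairing_linl _ _ Lw Lw Ll) (pairingC w) (pairing_linl _ _ Lw Lw Lw).
by rewrite !mul0r !addr0 mulrA mulN1r opprK mul1r.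
Qed.

Lemma H12S_opp v : H12S T v -> H12S T (- v) /\ normH12S T (- v) <= normH12S T v.
Proof.
apply: (@H12S_map (fun v => - v)).
- by move=> w hw; rewrite oppS_lincomb; exact: L2S_lin.
- move=> x hx; have [h e] := H1S_lin (-1) 0 hx hx; rewrite oppS_lincomb; split; first exact: h.
  have Lx := H1S_dt hx.
  rewrite (Q_ae (H1S_dt h) (L2S_lin _ _ Lx Lx) e) (Q_opp Lx).
  exact: lexx.
- by move=> x; rewrite opprD.
- by move=> w Lw; rewrite oppS_lincomb (Q_opp Lw).
Qed.

(** The embedding of H^1/2 in L^2, with the constant of Poincare's inequality in H^1. *)
Lemma H12S_embedding v : H12S T v -> Q v <= 4 * pi * T * normH12S T v ^+ 2.
Proof.
move=> [v1 v2]; have [h0 _] := H1S_0.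
have := @interp_sq_embedding _ _ (H1S T) (normH1S T) (normL2S T) h0 T v T0.
rewrite normL2S_sq (interp_normE h0 v2) -EFinM lee_fin; apply => x hx.
rewrite normL2S_sq normH1S_sq.
have Lx := H1S_L2S hx.
have Lvx : L2S T (v - x) by rewrite subS_lincomb; exact: L2S_lin.
rewrite -{1 2}(subrK x v) addS_lincomb.
have := Q_young ltr01 Lvx Lx; have := Q_poincare hx.
rewrite invr1; lra.
Qed.

Lemma normH12S_ge0 v : 0 <= normH12S T v.
Proof. exact: interp_norm_ge0. Qed.

Lemma normH12S_gt0 v : H12S T v -> ~ ae_eqS T v 0 -> 0 < normH12S T v.
Proof.
move=> hv nv; rewrite lt_neqAle normH12S_ge0 andbT eq_sym; apply/eqP => n0; apply: nv.
have := H12S_embedding hv; rewrite n0 expr0n/= mulr0 => Q0.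
apply: Q_eq0_ae; first by case: hv.
by apply/eqP; rewrite eq_le Q0 Q_ge0.
Qed.

Lemma normH12S_eq0 v : H12S T v -> ae_eqS T v 0 -> normH12S T v = 0.
Proof.
move=> [v1 v2] v0; have [h0 _] := H1S_0.
rewrite /normH12S /interp_norm interp_sq_eq0//= ?sqrtr0//; first exact: normH1S0.
by apply/eqP; rewrite sqrtr_eq0 (Q_ae v1 L2S_0 v0) pairing0l//; exact: L2S_0.
Qed.

Lemma H1S_H12S v : H1S T v -> H12S T v.
Proof.
move=> hv; have [h0 _] := H1S_0; apply: sub_interp_space => //; first exact: H1S_L2S.
- by apply/eqP; rewrite sqrtr_eq0 pairing0l//; exact: L2S_0.
- exact: normH1S0.
Qed.

Lemma norm_dualS_ge0 m : 0 <= norm_dualS T m.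
Proof.
by apply: sup_nonneg => _ [v _ <-]; rewrite divr_ge0// normH12S_ge0.
Qed.

(** The supremum that defines the dual norm is an upper bound of the quotients only because
    their set is bounded, which is what the embedding in L^2 provides. *)
Lemma pairing_dual m f : L2S T m -> H12S T f ->
  `|pairing T f m| <= normH12S T f * norm_dualS T m.
Proof.
move=> Lm hf; have Lf : L2S T f by case: hf.
have [f0|nf0] := pselect (ae_eqS T f 0).
  rewrite (pairing_ae Lf L2S_0 Lm f0) pairing0l// normr0 mulr_ge0 ?normH12S_ge0//.
  exact: norm_dualS_ge0.
have nf := normH12S_gt0 hf nf0.
rewrite mulrC -ler_pdivrMr//.
have /ub_le_sup : has_ubound [set `|pairing T m v| / normH12S T v
    | v in [set v | H12S T v /\ ~ ae_eqS T v 0]]; last first.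
  by apply; exists f => //; rewrite pairingC.
(* Young's inequality with the parameter [normH12S T v] has a homogeneous right-hand side. *)
exists (2^-1 * (Q m + 4 * pi * T)) => _ [v [hv nv] <-].
have n0 := normH12S_gt0 hv nv; have Lv : L2S T v by case: hv.
rewrite ler_pdivrMr//.
have := pairing_le n0 Lm Lv; have := H12S_embedding hv.
move: (normH12S T v) n0 (Q v) (Q m) `|_| (4 * pi * T) => n n0 q r p C h1 h2.
rewrite -(@ler_pM2l _ 2)//; apply: (le_trans h2).
have : n^-1 * q <= C * n by rewrite ler_pdivrMl// mulrCA -expr2.
lra.
Qed.

End Pairs.

(** * Boundedness of the operator *)

Section Operator.
Context {R : realType}.
Variables (T L : R) (neg : bool).
Hypotheses (T0 : 0 < T) (L0 : 0 < L).
Local Notation A := (halfIdK L neg).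
Local Notation Q v := (pairing T v v).
Local Notation c := ((-1) ^+ neg / 2 : R).
Implicit Types (u v w x y : sigma_fun R).

Definition delayS v : sigma_fun R := (delay L v.2, delay L v.1).

Lemma halfIdK_lincomb v : A v = lincomb c (- 2^-1) v (delayS v).
Proof.
by congr pair; apply/funext => t; rewrite /lincomb/= mulNr.
Qed.

Lemma halfIdKB u v : A u - A v = A (u - v).
Proof.
rewrite !subS_lincomb !halfIdK_lincomb; congr pair; apply/funext => t.
  by rewrite /= /delay /ext0/=; case: ifP => _; ring.
by rewrite /= /delay /ext0/=; case: ifP => _; ring.
Qed.

Lemma half_sign_sq : c ^+ 2 = 4^-1.
Proof. by rewrite exprMn sqrr_sign mul1r; field. Qed.

Lemma L2S_delayS v : L2S T v -> L2S T (delayS v).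
Proof. by move=> [v1 v2]; split; apply: L2I_delay. Qed.

Lemma Q_delayS v : L2S T v -> Q (delayS v) <= Q v.
Proof.
move=> [v1 v2]; rewrite !pairingE addrC.
by apply: lerD; apply: ipI_delay.
Qed.

Lemma H1S_delayS x : H1S T x ->
  H1S T (delayS x) /\ ae_eqS T (dt T (delayS x)) (delayS (dt T x)).
Proof.
move=> [h1 h2]; have [] := H10I_delay T0 L0 h1; have [] := H10I_delay T0 L0 h2.
by move=> ? ? ? ?; split; split.
Qed.

Lemma L2S_halfIdK v : L2S T v -> L2S T (A v).
Proof. by move=> Lv; rewrite halfIdK_lincomb; apply: L2S_lin => //; exact: L2S_delayS. Qed.

Lemma Q_lin_delayS v : L2S T v -> Q (lincomb c (- 2^-1) v (delayS v)) <= Q v.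
Proof.
move=> Lv; have Ld := L2S_delayS Lv.
have := Q_lin_le c (- 2^-1) Lv Ld; have := Q_delayS Lv.
by rewrite sqrrN half_sign_sq exprVn; lra.
Qed.

(** The delay is a contraction of L^2 that commutes with the weak derivative on H^1 functions
    vanishing at 0, so both coefficients being +-1/2, the operator is a contraction of L^2
    and of H^1; interpolation gives the same on H^1/2.  The operator norm is then the
    supremum of a bounded set. *)
Lemma H12S_halfIdK v : H12S T v -> H12S T (A v) /\ normH12S T (A v) <= normH12S T v.
Proof.
apply: (H12S_map T0).
- exact: L2S_halfIdK.
- move=> x hx; have [hd ed] := H1S_delayS hx; have Lx := H1S_dt hx.
  have Ld := H1S_dt hd; have Ldx := L2S_delayS Lx.
  have [h e] := H1S_lin T0 c (- 2^-1) hx hd.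
  rewrite halfIdK_lincomb; split; first exact: h.
  have Ll := L2S_lin c (- 2^-1) Lx Ldx.
  rewrite (Q_ae (H1S_dt h) Ll); first exact: Q_lin_delayS.
  case: e => e1 e2; case: ed => d1 d2; split.
    by apply: filterS2 e1 d1 => t e1 d1 It; rewrite (e1 It); congr (_ + _ * _); exact: (d1 It).
  by apply: filterS2 e2 d2 => t e2 d2 It; rewrite (e2 It); congr (_ + _ * _); exact: (d2 It).
- by move=> x; exact: halfIdKB.
- by move=> w Lw; rewrite halfIdK_lincomb; exact: Q_lin_delayS.
Qed.

Lemma opnorm_ge0 : 0 <= opnormH12S T A.
Proof.
by apply: sup_nonneg => _ [v _ <-]; rewrite divr_ge0// normH12S_ge0.
Qed.

Lemma opnorm_le v : H12S T v -> normH12S T (A v) <= opnormH12S T A * normH12S T v.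
Proof.
move=> hv; have [hA le] := H12S_halfIdK hv.
have [v0|nv] := pselect (ae_eqS T v 0).
  by move: le; rewrite (normH12S_eq0 T0 hv v0) mulr0.
have n0 := normH12S_gt0 T0 hv nv.
rewrite -ler_pdivrMr//.
have /ub_le_sup : has_ubound [set normH12S T (A v) / normH12S T v
    | v in [set v | H12S T v /\ ~ ae_eqS T v 0]]; last first.
  by apply; exists v.
exists 1 => _ [w [hw nw] <-]; have nw0 := normH12S_gt0 T0 hw nw.
by rewrite ler_pdivrMr// mul1r; have [] := H12S_halfIdK hw.
Qed.

End Operator.

(** * Discrete functions and the quasi-optimality estimate *)

Section Mesh.
Context {R : realType}.
Variables (T : R) (M : mesh T).
Hypothesis T0 : 0 < T.

Lemma S1_H12S v : S1 M v -> H12S T v.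
Proof.
move=> [h1 h2]; apply: (H1S_H12S T0); split.
  exact: (S1I_H10I T0 (nodes0P M) h1).
exact: (S1I_H10I T0 (nodesLP M) h2).
Qed.

Lemma S1_sub u v : S1 M u -> S1 M v -> S1 M (u - v).
Proof.
by move=> [u1 u2] [v1 v2]; rewrite subS_lincomb; split; apply: S1I_lin.
Qed.

End Mesh.
Theorem proposition5p1 (R : realType) (L T : R) (n : nat) (neg : bool)
    (M : mesh T) (c1K : R) (g z zh : sigma_fun R)
    (hL : 0 < L) (hn : (0 < n)%N) (hT : T = n%:R * L)
    (hadm : S1_admissible M)
    (hslice : time_slice_matching L n M)
    (hc : 0 < c1K)
    (hinfsup : forall wh, S1 M wh ->
       c1K * normH12S T wh <=
       sup [set `|pairing T (halfIdK L neg wh) muh| / norm_dualS T muh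
           | muh in [set muh | S1 M muh /\ ~ ae_eqS T muh 0]])
    (hg : H12S T g)
    (hz : H12S T z) (hzg : ae_eqS T (halfIdK L neg z) g)
    (hzh : S1 M zh)
    (hzhg : forall vh, S1 M vh ->
       pairing T (halfIdK L neg zh) vh = pairing T g vh) :
  normH12S T (z - zh) <=
  (1 + opnormH12S T (halfIdK L neg) / c1K) *
  inf [set normH12S T (z - vh) | vh in S1 M].
Proof.
have T0 : 0 < T by rewrite hT mulr_gt0// ltr0n.
set op := opnormH12S T (halfIdK L neg).
have op0 : 0 <= op by exact: opnorm_ge0.
have C0 : 0 < 1 + op / c1K by rewrite ltr_wpDr// divr_ge0// ltW.
rewrite -ler_pdivrMl//; apply: lb_le_inf.
  by exists (normH12S T (z - zh)); exists zh.
move=> _ [v hv <-]; rewrite ler_pdivrMl//.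
have Hv := S1_H12S T0 hv; have Hzh := S1_H12S T0 hzh.
have [Hnv _] := H12S_opp T0 Hv; have [Hzv _] := H12S_add T0 hz Hnv.
have [Hvz nvz] := H12S_opp T0 Hzv.
have hvzh := S1_sub hv hzh; have Hvzh := S1_H12S T0 hvzh.
have [HA _] := H12S_halfIdK neg T0 hL Hvz.
have [_] := H12S_add T0 Hzv Hvzh.
rewrite addrA subrK => /le_trans; apply.
rewrite mulrDl mul1r lerD2l mulrAC ler_pdivlMr// mulrC.
apply: (le_trans (hinfsup _ hvzh)).
have bound : op * normH12S T (- (z - v)) <= op * normH12S T (z - v) by exact: ler_wpM2l.
apply: le_trans bound; have bound2 := opnorm_le neg T0 hL Hvz.
apply: le_trans bound2.
set S := [set _ | _ in _].
have [Sne|/set0P/negP/negPn/eqP->] := pselect (S !=set0); last by rewrite sup0 normH12S_ge0.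
apply: (ge_sup Sne) => _ [m [hm nm] <-].
have Lm : L2S T m by case: (S1_H12S T0 hm).
have LA u : H12S T u -> L2S T (halfIdK L neg u) by move=> [? _]; exact: L2S_halfIdK.
(* Galerkin orthogonality: [z] and [zh] have the same image against [S1]. *)
have -> : pairing T (halfIdK L neg (v - zh)) m = pairing T (halfIdK L neg (- (z - v))) m.
  have Av := LA _ Hv; have Az := LA _ hz; have Azh := LA _ Hzh.
  have Lg : L2S T g by case: hg.
  rewrite opprB -!halfIdKB !subS_lincomb.
  rewrite (pairing_linl _ _ Av Azh Lm) (pairing_linl _ _ Av Az Lm).
  by rewrite (hzhg _ hm) (pairing_ae Az Lg Lm hzg).
(* Division by a vanishing dual norm gives 0. *)
have [d0|d0] := eqVneq (norm_dualS T m) 0.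
  by rewrite d0 invr0 mulr0 normH12S_ge0.
have dp : 0 < norm_dualS T m by rewrite lt_neqAle eq_sym d0 norm_dualS_ge0.
by rewrite ler_pdivrMr//; exact: pairing_dual.
Qed.
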